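(* In general, the canonical representation $Q_A$ of the Lie algebroid $A$ of a Lie groupoid $\mathcal{G}$ is not a representation of $\mathcal{G}$: there exist a manifold $M$ and a Lie groupoid $\mathcal{G}$ over $M$, with Lie algebroid $A$, such that the representation of $A$ on $Q_A$ is not induced (by differentiation) by any representation of $\mathcal{G}$ on the line bundle $Q_A$.
   Context: $\mathcal{G}$ is a Lie groupoid over $M$ with source $s$ and target $t$, all of whose $s$-fibers have the same dimension; $A=\ker(ds)|_M$ is its Lie algebroid, with anchor $\rho:A\to TM$ and bracket defined by right-invariant vector fields. $Q_A=\Lambda^{\mathrm{top}}A\otimes|\Lambda^{\mathrm{top}}T^*M|$, where $|L|$ denotes the density line bundle of a line bundle $L$; in particular $|\Lambda^{\mathrm{top}}T^*M|$ is the bundle of densities on $M$. $A$ acts on $Q_A$ by $\nabla_\alpha(X\otimes\mu)=\mathcal{L}_\alpha X\otimes\mu+X\otimes\mathcal{L}_{\rho(\alpha)}\mu$, where $\mathcal{L}_\alpha$ on $\Lambda^{\mathrm{top}}A$ is the extension of $[\alpha,\cdot]$ as a derivation and $\mathcal{L}_{\rho(\alpha)}$ is the usual Lie derivative of densities on $M$. A representation of $\mathcal{G}$ on a vector bundle $E\to M$ is a smooth linear action, where an arrow $g:x\to y$ acts by an isomorphism $E_x\to E_y$. It induces a representation of $A$ on $E$ by $\nabla_\alpha e(x)=\frac{d}{d\epsilon}\big|_{\epsilon=0}g_\epsilon^{-1}\cdot e(t(g_\epsilon))$, where $g_\epsilon$ is a curve in $s^{-1}(x)$ starting at the unit $1_x$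 with velocity $\alpha_x$. *)

(* Defs.v *)
From HB Require Import structures.
From mathcomp Require Import all_boot all_order all_algebra.
From mathcomp Require Import all_classical all_reals all_analysis.

Set Implicit Arguments.
Unset Strict Implicit.
Unset Printing Implicit Defensive.

Import Order.TTheory GRing.Theory Num.Theory.
Import numFieldNormedType.Exports.

Local Open Scope classical_set_scope.
Local Open Scope ring_scope.

(** * Smooth maps between finite-dimensional normed spaces *)

(* [f] is r times continuously differentiable on [D], for [D] open and [V],
   [W] finite-dimensional. *)
Fixpoint Cr (R : realType) (V W : normedModType R) (D : set V) (r : nat)
    (f : V -> W) {struct r} : Prop :=
  if r is r'.+1 then
    (forall x, D x -> differentiable f x) /\ (forall v : V, Cr D r' ('D_v f))
  else forall x, D x -> {for x, continuous f}.

Definition smooth_on (R : realType) (V W : normedModType R) (D : set V)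
    (f : V -> W) : Prop :=
  forall r, Cr D r f.

(** * Manifolds *)

(* A Hausdorff second countable space with a smooth atlas indexed by [chart].
   [coord c] and [icoord c] are only meaningful on [dom c] and on its image.
   Each point [p] has a preferred chart [chart_at p], and a tangent vector at
   [p] is represented by its coordinates in that chart: T_p M is 'rV[R]_n. *)
Record manifold (R : realType) (n : nat) := Manifold {
  carrier :> topologicalType;
  chart : Type;
  dom : chart -> set carrier;
  coord : chart -> carrier -> 'rV[R]_n;
  icoord : chart -> 'rV[R]_n -> carrier;
  chart_at : carrier -> chart;
  manifold_hausdorff : hausdorff_space carrier;
  manifold_countable : @second_countable carrier;
  dom_open : forall c, open (dom c);
  cod_open : forall c, open (coord c @` dom c);
  coordK : forall c p, dom c p -> icoord c (coord c p) = p;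
  coord_continuous : forall c p, dom c p -> {for p, continuous (coord c)};
  icoord_continuous : forall c y, (coord c @` dom c) y ->
    {for y, continuous (icoord c)};
  dom_chart_at : forall p, dom (chart_at p) p;
  transition_smooth : forall c d,
    smooth_on (coord c @` (dom c `&` dom d)) (coord d \o icoord c)
}.

Section SmoothMaps.
Context {R : realType}.

Definition smooth_into (V : normedModType R) (n : nat) (N : manifold R n)
    (D : set V) (f : V -> N) : Prop :=
  (forall y, D y -> {for y, continuous f}) /\
  (forall d : chart N, smooth_on (D `&` f @^-1` dom d) (coord d \o f)).

Definition smooth_map (m n : nat) (M : manifold R m) (N : manifold R n)
    (f : M -> N) : Prop :=
  forall c : chart M, smooth_into (coord c @` dom c) (f \o icoord c).

Definition smooth_fun (n : nat) (M : manifold R n) (W : normedModType R)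
    (U : set M) (f : M -> W) : Prop :=
  forall c : chart M, smooth_on (coord c @` (dom c `&` U)) (f \o icoord c).

(* The tangent map T_p M -> T_(f p) N, acting on row vectors from the right. *)
Definition tmx (m n : nat) (M : manifold R m) (N : manifold R n)
    (f : M -> N) (p : M) : 'M[R]_(m, n) :=
  'J (coord (chart_at (f p)) \o f \o icoord (chart_at p))
     (coord (chart_at p) p).

(* The components in the chart [d] of the tangent vector [v] at [p]. *)
Definition tcoord (n : nat) (M : manifold R n) (d : chart M) (p : M)
    (v : 'rV[R]_n) : 'rV[R]_n :=
  v *m 'J (coord d \o icoord (chart_at p)) (coord (chart_at p) p).

(* Smoothness over [U] of a vector field [v] along [f], i.e. of the map
   x |-> (f x, v x) into TN, where [v x] is tangent to N at [f x]. *)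
Definition smooth_along (m n : nat) (M : manifold R m) (N : manifold R n)
    (U : set M) (f : M -> N) (v : M -> 'rV[R]_n) : Prop :=
  forall (c : chart M) (d : chart N),
    smooth_on (coord c @` (dom c `&` U `&` f @^-1` dom d))
      (fun y => tcoord d (f (icoord c y)) (v (icoord c y))).

Definition submersion (m n : nat) (M : manifold R m) (N : manifold R n)
    (f : M -> N) : Prop :=
  smooth_map f /\ forall p, \rank (tmx f p) = n.

Definition velocity (n : nat) (M : manifold R n) (c : R -> M) (e : R) :
    'rV[R]_n :=
  derive1 (coord (chart_at (c e)) \o c) e.

Definition fun_deriv (n : nat) (M : manifold R n) (f : M -> R) (p : M)
    (v : 'rV[R]_n) : R :=
  'D_v (f \o icoord (chart_at p)) (coord (chart_at p) p).

Definition lie_bracket (n : nat) (M : manifold R n) (v w : M -> 'rV[R]_n)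
    (p : M) : 'rV[R]_n :=
  let c := chart_at p in
  let vc y := tcoord c (icoord c y) (v (icoord c y)) in
  let wc y := tcoord c (icoord c y) (w (icoord c y)) in
  let y := coord c p in
  'D_(vc y) wc y - 'D_(wc y) vc y.

Definition is_flow (n : nat) (M : manifold R n) (v : M -> 'rV[R]_n)
    (U : set M) (delta : R) (Phi : R -> M -> M) : Prop :=
  [/\ open U, 0 < delta,
      forall y, U y -> Phi 0 y = y,
      forall c : chart M,
        smooth_into
          [set z : R * 'rV[R]_n |
            `|z.1| < delta /\ (coord c @` (dom c `&` U)) z.2]
          (fun z => Phi z.1 (icoord c z.2)) &
      forall y e, U y -> `|e| < delta -> velocity (Phi^~ y) e = v (Phi e y)].

End SmoothMaps.

(** * Lie groupoids *)

(* [gmul g h] is meaningful when [src g = tgt h]. The arrows form a manifold of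
   dimension n + k, so all source fibers have dimension k. Smoothness of [gmul]
   is that of a map defined on a submanifold of the product: locally it
   extends to a smooth map of the coordinates of both factors. *)
Record lieGroupoid (R : realType) (n k : nat) (M : manifold R n) :=
  LieGroupoid {
  arrow :> manifold R (n + k);
  src : arrow -> M;
  tgt : arrow -> M;
  unt : M -> arrow;
  ginv : arrow -> arrow;
  gmul : arrow -> arrow -> arrow;
  src_unt : forall x, src (unt x) = x;
  tgt_unt : forall x, tgt (unt x) = x;
  src_mul : forall g h, src g = tgt h -> src (gmul g h) = src h;
  tgt_mul : forall g h, src g = tgt h -> tgt (gmul g h) = tgt g;
  mul_assoc : forall f g h, src f = tgt g -> src g = tgt h ->
    gmul f (gmul g h) = gmul (gmul f g) h;
  mul_unt_l : forall g, gmul (unt (tgt g)) g = g;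
  mul_unt_r : forall g, gmul g (unt (src g)) = g;
  src_inv : forall g, src (ginv g) = tgt g;
  tgt_inv : forall g, tgt (ginv g) = src g;
  mul_inv_l : forall g, gmul (ginv g) g = unt (src g);
  mul_inv_r : forall g, gmul g (ginv g) = unt (tgt g);
  src_submersion : submersion src;
  tgt_submersion : submersion tgt;
  unt_smooth : smooth_map unt;
  inv_smooth : smooth_map ginv;
  mul_smooth : forall g h, src g = tgt h ->
    exists (D : set ('rV[R]_(n + k) * 'rV[R]_(n + k)))
           (F : 'rV[R]_(n + k) * 'rV[R]_(n + k) -> 'rV[R]_(n + k)),
      [/\ open D, D (coord (chart_at g) g, coord (chart_at h) h),
          smooth_on D F &
          \forall z \near (g, h), src z.1 = tgt z.2 ->
            dom (chart_at (gmul g h)) (gmul z.1 z.2) /\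
            F (coord (chart_at g) z.1, coord (chart_at h) z.2) =
              coord (chart_at (gmul g h)) (gmul z.1 z.2)]
}.

(** * Top exterior powers and densities *)

Section Lines.
Context {R : realType}.

(* Subspaces of R^d are row spaces of matrices; a basis is the list of rows
   of [a]. *)
Definition basis_mx (k d : nat) (V : 'M[R]_d) (a : 'M[R]_(k, d)) : bool :=
  row_free a && (a == V)%MS.

(* An element X of Lambda^top V is given by its coefficient [X a] on
   a_1 /\ .. /\ a_k, for every basis a of V. *)
Definition top_power (k d : nat) (V : 'M[R]_d) : set ('M[R]_(k, d) -> R) :=
  [set X | (forall a P, basis_mx V a -> P \in unitmx ->
              X (P *m a) = (\det P)^-1 * X a) /\
           (forall a, ~~ basis_mx V a -> X a = 0)].

(* b_1 /\ .. /\ b_k in Lambda^top V, for b_1, .., b_k in V. *)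
Definition wedge (k d : nat) (V : 'M[R]_d) (b : 'M[R]_(k, d)) :
    'M[R]_(k, d) -> R :=
  fun a => if basis_mx V a then \det (b *m pinvmx a) else 0.

(* An element of |Lambda^top V^*|, V = R^n, as a function of bases of V. *)
Definition density (n : nat) : set ('M[R]_n -> R) :=
  [set mu | (forall e P, e \in unitmx -> P \in unitmx ->
               mu (P *m e) = `|\det P| * mu e) /\
            (forall e, e \notin unitmx -> mu e = 0)].

Definition tensor (S T : Type) (X : S -> R) (mu : T -> R) : S -> T -> R :=
  fun a e => X a * mu e.

End Lines.

Section CanonicalRepresentation.
Context {R : realType} {n k : nat} {M : manifold R n} (G : lieGroupoid k M).

(** * The Lie algebroid *)

(* The row space of [algd x] is A_x = ker (ds) at the unit of x. *)
Definition algd (x : M) : 'M[R]_(n + k) :=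
  kermx (tmx (@src _ _ _ _ G) (unt G x)).

Definition anchor (alpha : M -> 'rV[R]_(n + k)) (x : M) : 'rV[R]_n :=
  alpha x *m tmx (@tgt _ _ _ _ G) (unt G x).

Definition sectionA (U : set M) (alpha : M -> 'rV[R]_(n + k)) : Prop :=
  (forall x, U x -> (alpha x <= algd x)%MS) /\ smooth_along U (unt G) alpha.

(* [c] is a curve, defined near 0, in the source fiber of [x], with
   c 0 = unt x and velocity [v] at 0. *)
Definition src_curve (x : M) (v : 'rV[R]_(n + k)) (c : R -> G) : Prop :=
  exists D : set R,
    [/\ open D /\ D 0, smooth_into D c, forall e, D e -> src (c e) = x,
        c 0 = unt G x & velocity c 0 = v].

(* The right-invariant vector field of alpha: at g it is the image of
   alpha (tgt g) under the differential of h |-> gmul h g. *)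
Definition right_inv (alpha : M -> 'rV[R]_(n + k)) (g : G) : 'rV[R]_(n + k) :=
  xget 0 [set w | exists c, src_curve (tgt g) (alpha (tgt g)) c /\
                            w = velocity (fun e => gmul (c e) g) 0].

Definition bracketA (alpha beta : M -> 'rV[R]_(n + k)) (x : M) :
    'rV[R]_(n + k) :=
  lie_bracket (right_inv alpha) (right_inv beta) (unt G x).

(** * The line bundle Q_A *)

Definition frameA (U : set M) (a : M -> 'M[R]_(k, n + k)) : Prop :=
  [/\ open U, forall x, U x -> basis_mx (algd x) (a x) &
      forall i, smooth_along U (unt G) (fun x => row i (a x))].

Definition frameT (U : set M) (e : M -> 'M[R]_n) : Prop :=
  [/\ open U, forall x, U x -> e x \in unitmx &
      forall i, smooth_along U id (fun x => row i (e x))].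

Definition section_top (X : M -> 'M[R]_(k, n + k) -> R) : Prop :=
  (forall x, top_power (algd x) (X x)) /\
  (forall U a, frameA U a -> smooth_fun U (fun x => X x (a x))).

Definition section_density (mu : M -> 'M[R]_n -> R) : Prop :=
  (forall x, density (mu x)) /\
  (forall U e, frameT U e -> smooth_fun U (fun x => mu x (e x))).

(* Every element of a tensor product of two lines is a pure tensor. *)
Definition fiberQ (x : M) : set ('M[R]_(k, n + k) -> 'M[R]_n -> R) :=
  [set q | exists X mu, [/\ top_power (algd x) X, density mu &
                            q = tensor X mu]].

Definition sectionQ (U : set M) (q : M -> 'M[R]_(k, n + k) -> 'M[R]_n -> R) :
    Prop :=
  (forall x, U x -> fiberQ x (q x)) /\
  (forall V a e, frameA V a -> frameT V e ->
     smooth_fun (U `&` V) (fun x => q x (a x) (e x))).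

(** * The canonical action of A on Q_A *)

(* L is the Lie derivative of X along alpha. Over a local frame a, with
   X = f a_1 /\ .. /\ a_k, the derivation property reads
   L = (rho(alpha) f) a_1 /\ .. /\ a_k
       + f sum_i a_1 /\ .. /\ [alpha, a_i] /\ .. /\ a_k. *)
Definition is_lie_top (alpha : M -> 'rV[R]_(n + k))
    (X L : M -> 'M[R]_(k, n + k) -> R) : Prop :=
  forall U a, frameA U a -> forall x, U x -> forall b,
    L x b =
      fun_deriv (fun y => X y (a y)) x (anchor alpha x)
        * wedge (algd x) (a x) b
      + X x (a x) *
        \sum_(i < k)
          wedge (algd x)
            (\matrix_(j < k)
               (if j == i then bracketA alpha (fun y => row i (a y)) x
                else row j (a x))) b.

(* L is the Lie derivative of mu along v, the derivative at 0 of the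
   pullbacks of mu by the flow of v. *)
Definition is_lie_density (v : M -> 'rV[R]_n) (mu L : M -> 'M[R]_n -> R) :
    Prop :=
  forall U delta Phi, is_flow v U delta Phi ->
  forall x, U x -> forall e,
    is_derive (0 : R) (1 : R)
      (fun t => mu (Phi t x) (e *m tmx (Phi t) x)) (L x e).

(* q' is the derivative of q along alpha, for the canonical representation.
   Densities are trivializable, so every smooth section q of Q_A is of the
   form X (x) mu with global X and mu. *)
Definition nablaQ (alpha : M -> 'rV[R]_(n + k))
    (q q' : M -> 'M[R]_(k, n + k) -> 'M[R]_n -> R) : Prop :=
  exists X mu LX Lmu,
    [/\ section_top X /\ section_density mu,
        is_lie_top alpha X LX, is_lie_density (anchor alpha) mu Lmu,
        forall x, q x = tensor (X x) (mu x) &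
        forall x a e,
          q' x a e = tensor (LX x) (mu x) a e + tensor (X x) (Lmu x) a e].

(** * Representations of G on Q_A *)

(* [Theta g] is only meaningful on the fiber over [src g]. *)
Definition is_representation
    (Theta : G -> ('M[R]_(k, n + k) -> 'M[R]_n -> R) ->
                  ('M[R]_(k, n + k) -> 'M[R]_n -> R)) : Prop :=
  [/\ forall g q, fiberQ (src g) q -> fiberQ (tgt g) (Theta g q),
      forall g (l : R) q r, fiberQ (src g) q -> fiberQ (src g) r ->
        forall a e, Theta g (fun a e => l * q a e + r a e) a e =
                    l * Theta g q a e + Theta g r a e,
      forall x q, fiberQ x q -> Theta (unt G x) q = q,
      forall g h q, src g = tgt h -> fiberQ (src h) q ->
        Theta (gmul g h) q = Theta g (Theta h q) &
      forall U q V a e, open U -> sectionQ U q -> frameA V a -> frameT V e ->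
        smooth_fun ((@src _ _ _ _ G) @^-1` U `&` (@tgt _ _ _ _ G) @^-1` V)
          (fun g => Theta g (q (src g)) (a (tgt g)) (e (tgt g)))].

(* q' is the derivative of q along alpha, for the representation of A induced
   by Theta. *)
Definition nabla_induced
    (Theta : G -> ('M[R]_(k, n + k) -> 'M[R]_n -> R) ->
                  ('M[R]_(k, n + k) -> 'M[R]_n -> R))
    (alpha : M -> 'rV[R]_(n + k))
    (q q' : M -> 'M[R]_(k, n + k) -> 'M[R]_n -> R) : Prop :=
  forall x c, src_curve x (alpha x) c -> forall a e,
    is_derive (0 : R) (1 : R)
      (fun t => Theta (ginv (c t)) (q (tgt (c t))) a e) (q' x a e).

Definition induces_canonical
    (Theta : G -> ('M[R]_(k, n + k) -> 'M[R]_n -> R) ->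
                  ('M[R]_(k, n + k) -> 'M[R]_n -> R)) : Prop :=
  forall alpha q q', sectionA setT alpha -> nablaQ alpha q q' ->
    nabla_induced Theta alpha q q'.

End CanonicalRepresentation.

Arguments is_representation {R n k M} G Theta.
Arguments induces_canonical {R n k M} G Theta.

(* Main.v *)
From Pilot Require Import Defs.
From HB Require Import structures.
From mathcomp Require Import all_boot all_order all_algebra.
From mathcomp Require Import all_classical all_reals all_analysis.
From mathcomp Require Import ring lra.

Set Implicit Arguments.
Unset Strict Implicit.
Unset Printing Implicit Defensive.

Import Pilot.Defs.
Import Order.TTheory GRing.Theory Num.Theory.
Import numFieldNormedType.Exports.

Local Open Scope classical_set_scope.
Local Open Scope ring_scope.

(** Take for M the Moebius band and for the groupoid the pair groupoid of M,
    which has exactly one arrow between any two points.  Its Lie algebroid is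
    TM, so Q_A = Lambda^2 TM (x) |Lambda^2 T^*M| is the orientation line of M.
    A representation of the pair groupoid on any line bundle trivializes it: fix
    a point x0 and a nonzero vector over x0, and transport it to every x along
    the arrow x0 -> x.  A nowhere vanishing section of Q_A is an orientation of
    M, which the Moebius band does not have.  Hence there is no representation on
    Q_A, let alone one that induces the canonical representation of A.

    In coordinates, every chart c of M gives the frame of TM by its coordinate
    fields, and the transported section gets a coefficient h_c in this frame
    ([pair_representation_orientable]).  It is continuous and does not vanish on
    the domain of c, and on an overlap with a chart d it obeys
    h_c = det(P)^-1 |det P| h_d, with P the Jacobian matrix of the transition;
    so h_c h_d det P > 0.  On the Moebius band with its two charts over strips
    (-1, 1) x R, each h_c has a constant sign along the core circle cut open
    ([nonvanishing_same_sign]), while det P is 1 on one component of the overlap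
    and -1 on the other ([mobius_nonorientable]).

    Continuity of h_c comes from the smoothness clause of a representation, which
    only speaks of smooth sections of Q_A and smooth frames.  This calls for one
    nonzero smooth section near x0 ([chart_section]), whose values on an arbitrary
    frame are quotients of determinants of C^r functions and their absolute
    values, and for the smoothness of coordinate frames, whose entries are
    derivatives of transition maps. *)

(** * Calculus of C^r maps *)

Section Calculus.
Context {R : realType}.
Implicit Types V W : normedModType R.

Lemma near_eq_differentiable V W (f g : V -> W) (a : V) :
  (\near a, f a = g a) -> differentiable f a -> differentiable g a.
Proof.
move=> fg /diff_locallyP[dfc dfE].
have fg0 : \forall h \near (0 : V), f (h + a) = g (h + a).
  by move: fg; rewrite (near_shift (0 : V)) /= subr0.
have dgE : g \o shift a = cst (g a) + 'd f a +o_ (0 : V) id.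
  apply/eqaddoP => e e0; move/eqaddoP: dfE => /(_ e e0).
  apply: filter_app; move: fg0; apply: filterS => h fgh /=.
  by rewrite !fctE /= fgh (nbhs_singleton fg).
by apply/diff_locallyP; rewrite (diff_unique dfc dgE).
Qed.

Lemma linear_rV_continuous n W (L : {linear 'rV[R]_n -> W}) : continuous L.
Proof.
have -> : (L : _ -> _) = \sum_j (fun v : 'rV[R]_n => v ord0 j *: L ('e_j)).
  apply/funext => v; rewrite fct_sumE {1}(row_sum_delta v) linear_sum.
  by apply: eq_bigr => j _; rewrite linearZ.
elim/big_ind : _ => [v|f g fc gc v|j _ v]; first exact: (@cst_continuous _ _ (0 : W)).
  exact: cvgD (fc v) (gc v).
have cj : continuous (fun u : 'rV[R]_n => u ord0 j) := @matrix_normedtype.coord_continuous R 1 n ord0 j.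
exact: cvgZr_tmp (cj v).
Qed.

Lemma near_eq_for_continuous (T : topologicalType) W (f g : T -> W) (a : T) :
  (\near a, f a = g a) -> {for a, continuous f} -> {for a, continuous g}.
Proof.
move=> fg fa; have fga := nbhs_singleton fg.
rewrite /prop_for /continuous_at -fga => A fA.
by have := fa A fA; rewrite /nbhs /=; apply: filterS2 fg => y /= ->.
Qed.

Lemma open_near (T : topologicalType) (D : set T) (P : T -> Prop) x :
  open D -> D x -> (forall y, D y -> P y) -> \near x, P x.
Proof. by move=> Do Dx DP; apply: filterS (open_nbhs_nbhs (conj Do Dx)). Qed.

Lemma Cr_sub V W (D D' : set V) r (f : V -> W) :
  D' `<=` D -> Cr D r f -> Cr D' r f.
Proof.
move=> D'D; elim: r f => [|r IH] f /=; first by move=> h x /D'D /h.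
by case=> df dDf; split=> [x /D'D /df //|v]; exact: IH.
Qed.

(** Openness of D matters: derivatives at a point of D see the values of the
    functions in a neighborhood. *)
Lemma Cr_ext V W (D : set V) r (f g : V -> W) : open D ->
  (forall x, D x -> f x = g x) -> Cr D r f -> Cr D r g.
Proof.
move=> Do; elim: r f g => [|r IH] f g fg /=.
  by move=> fc x Dx; apply: near_eq_for_continuous (fc _ Dx); exact: open_near fg.
case=> df dDf; split=> [x Dx|v].
  by apply: near_eq_differentiable (df _ Dx); exact: open_near fg.
apply: (IH ('D_v f)) => // x Dx.
by apply: near_eq_derive; exact: open_near fg.
Qed.

Lemma CrS V W (D : set V) r (f : V -> W) : Cr D r.+1 f -> Cr D r f.
Proof.
elim: r f => [|r IH] f [df dDf].
  by move=> x Dx; apply: differentiable_continuous; exact: df.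
by split=> // v; apply: IH; exact: dDf.
Qed.

Lemma Cr_union V W (D E : set V) r
    (f : V -> W) : Cr D r f -> Cr E r f -> Cr (D `|` E) r f.
Proof.
elim: r f => [|r IH] f /=; first by move=> fD fE x [/fD|/fE].
move=> [dD hD] [dE hE]; split=> [x [/dD|/dE] //|v].
exact: (IH _ (hD v) (hE v)).
Qed.

Lemma Cr_cst V W (D : set V) r (w : W) : Cr D r (cst w).
Proof.
elim: r w => [|r IH] w /=; first by move=> x _; exact: cst_continuous.
split=> // v; rewrite [X in Cr _ _ X](_ : _ = cst 0)//.
by apply/funext => x; rewrite derive_cst.
Qed.

Lemma Cr_id V (D : set V) r : Cr D r (@id V).
Proof.
case: r => [|r] /=; first by move=> x _; exact: cvg_id.
split=> // v; rewrite [X in Cr _ _ X](_ : _ = cst v); first exact: Cr_cst.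
by apply/funext => x; rewrite derive_id.
Qed.

Lemma Cr_add V W (D : set V) r (f g : V -> W) : open D ->
  Cr D r f -> Cr D r g -> Cr D r (fun x => f x + g x).
Proof.
move=> Do; elim: r f g => [|r IH] f g /=.
  by move=> fc gc x Dx; apply: cvgD; [exact: fc | exact: gc].
case=> df dDf [dg dDg]; split=> [x Dx|v].
  by apply: differentiableD; [exact: df | exact: dg].
apply: (Cr_ext Do _ (IH _ _ (dDf v) (dDg v))) => x Dx.
by rewrite deriveD //; apply: diff_derivable; [exact: df|exact: dg].
Qed.

Lemma Cr_linear V W W' (D : set V) r (L : {linear W -> W'}) (f : V -> W) :
  open D -> continuous L -> Cr D r f -> Cr D r (L \o f).
Proof.
move=> Do Lc; elim: r f => [|r IH] f /=.
  by move=> fc x Dx; apply: continuous_comp; [exact: fc | exact: Lc].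
case=> df dDf; have dL x : differentiable L x by exact: linear_differentiable.
split=> [x Dx|v]; first by apply: differentiable_comp; [exact: df|].
apply: (Cr_ext Do _ (IH _ (dDf v))) => x Dx.
have dfx := df _ Dx.
rewrite (deriveE _ (differentiable_comp dfx (dL (f x)))).
by rewrite (diff_comp dfx (dL (f x))) /= (diff_lin (f x) Lc) (deriveE _ dfx).
Qed.

Lemma Cr_comp_linear V V' W (D : set V) r (L : {linear V' -> V}) (f : V -> W) :
  open D -> continuous L -> Cr D r f -> Cr (L @^-1` D) r (f \o L).
Proof.
move=> Do Lc; have LDo : open (L @^-1` D) by apply: open_comp.
elim: r f => [|r IH] f /=.
  by move=> fc x Dx; apply: continuous_comp; [exact: Lc | exact: fc].
case=> df dDf; have dL x : differentiable L x by exact: linear_differentiable.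
split=> [x Dx|v]; first by apply: differentiable_comp; [|exact: df].
apply: (Cr_ext LDo _ (IH _ (dDf (L v)))) => x Dx.
have dfx := df _ Dx.
rewrite /= (deriveE _ dfx) (deriveE _ (differentiable_comp (dL x) dfx)).
by rewrite (diff_comp (dL x) dfx) /= (diff_lin x Lc).
Qed.

Lemma Cr_mul V (D : set V) r (f g : V -> R) : open D ->
  Cr D r f -> Cr D r g -> Cr D r (fun x => f x * g x).
Proof.
move=> Do; elim: r f g => [|r IH] f g.
  by move=> /= fc gc x Dx; apply: cvgM; [exact: fc | exact: gc].
move=> fS gS; have [df dDf] := fS; have [dg dDg] := gS.
split=> [x Dx|v]; first by apply: differentiableM; [exact: df | exact: dg].
apply: (Cr_ext Do _ (Cr_add Do (IH _ _ (CrS fS) (dDg v))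
                               (IH _ _ (CrS gS) (dDf v)))) => x Dx.
by rewrite deriveM //; apply: diff_derivable; [exact: df|exact: dg].
Qed.

(** D_v (f^-1) = - f^-1 f^-1 D_v f is a product of functions already known to
    be C^r. *)
Lemma Cr_inv V (D : set V) r (f : V -> R) : open D ->
  (forall x, D x -> f x != 0) -> Cr D r f -> Cr D r (fun x => (f x)^-1).
Proof.
move=> Do f0; elim: r => [|r IH].
  by move=> /= fc x Dx; apply: cvgV; [exact: f0 | exact: fc].
move=> fS; have [df dDf] := fS.
split=> [x Dx|v]; first by apply: differentiableV; [exact: df | exact: f0].
have fV := IH (CrS fS).
have c1 : Cr D r (cst (-1) : V -> R) by exact: Cr_cst.
apply: (Cr_ext Do _ (Cr_mul Do (Cr_mul Do c1 (Cr_mul Do fV fV)) (dDf v))) => x Dx.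
rewrite deriveV; [|exact: f0|by apply: diff_derivable; exact: df].
by rewrite /cst /= expr2 invfM mulN1r.
Qed.

Lemma near_norm V (f : V -> R) x : {for x, continuous f} -> f x != 0 ->
  \forall y \near x, Num.sg (f x) * f y = `|f y|.
Proof.
move=> fc; case: (ltgtP (f x) 0) => [fx0 _|fx0 _|//].
  have : \forall y \near x, f y < 0 by exact: (fc _ (lt_nbhsl fx0)).
  apply: filterS => y fy.
  by rewrite ltr0_norm // ltr0_sg // mulN1r.
have : \forall y \near x, 0 < f y by exact: (fc _ (lt_nbhsr fx0)).
by apply: filterS => y fy; rewrite gtr0_norm // gtr0_sg // mul1r.
Qed.

(** The derivative of the absolute value of f is again a product of C^r
    functions, D_v |f| = |f| f^-1 D_v f, so that the induction closes. *)
Lemma Cr_norm V (D : set V) r (f : V -> R) : open D ->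
  (forall x, D x -> f x != 0) -> Cr D r f -> Cr D r (fun x => `|f x|).
Proof.
move=> Do f0; elim: r => [|r IH].
  move=> /= fc x Dx; apply: (@continuous_comp _ _ _ f Num.norm); first exact: fc.
  exact: norm_continuous.
move=> fS; have [df dDf] := fS.
have nf x : D x -> \forall y \near x, Num.sg (f x) * f y = `|f y|.
  by move=> Dx; apply: near_norm (f0 _ Dx); exact/differentiable_continuous/df.
split=> [x Dx|v].
  apply: near_eq_differentiable (nf _ Dx) _.
  by apply: differentiableM; [exact: differentiable_cst | exact: df].
have fV := Cr_inv Do f0 (CrS fS).
apply: (Cr_ext Do _ (Cr_mul Do (Cr_mul Do (IH (CrS fS)) fV) (dDf v))) => x Dx.
rewrite -(near_eq_derive _ (nf _ Dx)) (@deriveM _ _ (cst _) f) ?derive_cst.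
- rewrite scaler0 addr0 /cst; congr (_ * _).
  by rewrite [X in X / _]normrEsg mulfK // f0.
- by apply: diff_derivable; exact: differentiable_cst.
- by apply: diff_derivable; exact: df.
Qed.

Lemma Cr_sum V W (D : set V) r (I : Type) (s : seq I) (P : pred I)
    (f : I -> V -> W) : open D -> (forall i, P i -> Cr D r (f i)) ->
  Cr D r (fun x => \sum_(i <- s | P i) f i x).
Proof.
move=> Do fi; rewrite -fct_sumE; elim/big_ind : _ => [|g h|//].
  exact: Cr_cst.
exact: Cr_add.
Qed.

Lemma Cr_prod V (D : set V) r (I : Type) (s : seq I) (P : pred I)
    (f : I -> V -> R) : open D -> (forall i, P i -> Cr D r (f i)) ->
  Cr D r (fun x => \prod_(i <- s | P i) f i x).
Proof.
move=> Do fi; rewrite -fct_prodE; elim/big_ind : _ => [|g h|//].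
  exact: Cr_cst.
exact: Cr_mul.
Qed.

Lemma Cr_det V (D : set V) r n (A : V -> 'M[R]_n) : open D ->
  (forall i j, Cr D r (fun x => A x i j)) -> Cr D r (fun x => \det (A x)).
Proof.
move=> Do Aij; apply: Cr_sum => // s _; apply: Cr_mul => //; first exact: Cr_cst.
exact: Cr_prod.
Qed.

Lemma Cr_coord V (D : set V) r n (f : V -> 'rV[R]_n) j : open D ->
  Cr D r f -> Cr D r (fun x => f x ord0 j).
Proof.
move=> Do fr.
have cl : linear (fun v : 'rV[R]_n => v ord0 j) by move=> a u v; rewrite !mxE.
pose L : {linear 'rV[R]_n -> R^o} :=
  HB.pack (fun v : 'rV[R]_n => v ord0 j) (GRing.isLinear.Build _ _ _ _ _ cl).
exact: (Cr_linear Do (@linear_rV_continuous _ _ L) fr).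
Qed.

Lemma Cr_rV V (D : set V) r n (f : V -> 'rV[R]_n) : open D ->
  (forall j, Cr D r (fun x => f x ord0 j)) -> Cr D r f.
Proof.
move=> Do fr; have -> : f = (fun x => \sum_j f x ord0 j *: 'e_j).
  by apply/funext => x; exact: row_sum_delta.
apply: Cr_sum => // j _.
have cl : linear ( *:%R ^~ ('e_j : 'rV[R]_n)).
  by move=> a u v; rewrite scalerDl scalerA.
pose L : {linear R^o -> 'rV[R]_n} :=
  HB.pack ( *:%R ^~ ('e_j : 'rV[R]_n)) (GRing.isLinear.Build _ _ _ _ _ cl).
by apply: (@Cr_linear _ _ _ _ _ L) (fr j) => //; exact: scalel_continuous.
Qed.

Lemma derive_comp n V (f : 'rV[R]_n -> R) (g : V -> 'rV[R]_n) x v :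
  differentiable g x -> differentiable f (g x) ->
  'D_v (f \o g) x = \sum_j 'D_v g x ord0 j * 'D_('e_j) f (g x).
Proof.
move=> dg df; rewrite deriveE; last exact: differentiable_comp.
rewrite diff_comp //= -(deriveE v dg) {1}(row_sum_delta ('D_v g x)) linear_sum.
by apply: eq_bigr => j _; rewrite linearZ /= (deriveE _ df).
Qed.

(** Induction through the chain rule of [derive_comp]: the partial derivatives of
    f are again composed with g. *)
Lemma Cr_comp V n (D : set V) (D' : set 'rV[R]_n) r (f : 'rV[R]_n -> R)
    (g : V -> 'rV[R]_n) : open D -> (forall x, D x -> D' (g x)) ->
  Cr D' r f -> Cr D r g -> Cr D r (f \o g).
Proof.
move=> Do gD; elim: r f => [|r IH] f.
  move=> /= fc gc x Dx; apply: (@continuous_comp _ _ _ g f); first exact: gc.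
  by apply: fc; exact: gD.
move=> fS gS; have [df dDf] := fS; have [dg dDg] := gS.
split=> [x Dx|v].
  by apply: differentiable_comp; [exact: dg | by apply: df; exact: gD].
apply: (@Cr_ext _ _ _ _ (fun x => \sum_j 'D_v g x ord0 j * 'D_('e_j) f (g x))) => //.
  by move=> x Dx; rewrite derive_comp //; [exact: dg | by apply: df; exact: gD].
apply: Cr_sum => // j _; apply: Cr_mul => //.
  exact: (Cr_coord j Do (dDg v)).
exact: IH (dDf _) (CrS gS).
Qed.

End Calculus.

(** * Topology and Jacobian matrices *)

Section Topology.

(** Continuous maps to a Hausdorff space factor through the largest Hausdorff
    quotient; this separates the points of products and of subspaces. *)
Lemma cluster_map_eq (T U : topologicalType) (f : T -> U) p q :
  continuous f -> hausdorff_space U -> cluster (nbhs p) q -> f p = f q.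
Proof.
move=> fc hU pq; apply: hU => A B fpA fqB.
by have [x [Ax Bx]] := pq _ _ (fc p A fpA) (fc q B fqB); exists (f x).
Qed.

Lemma hausdorff_prod (T U : topologicalType) :
  hausdorff_space T -> hausdorff_space U -> hausdorff_space (T * U)%type.
Proof.
move=> hT hU [p1 p2] [q1 q2] pq; congr pair.
  by apply: (@cluster_map_eq _ _ fst _ _ _ hT pq) => x; exact: cvg_fst.
by apply: (@cluster_map_eq _ _ snd _ _ _ hU pq) => x; exact: cvg_snd.
Qed.

Lemma second_countable_prod (T U : topologicalType) :
  @second_countable T -> @second_countable U -> @second_countable (T * U)%type.
Proof.
move=> [B cB [oB bB]] [C cC [oC bC]].
exists ((fun p => p.1 `*` p.2) @` (B `*` C)).
  by apply: sub_countable (card_image_le _ _) _; exact: countableX.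
split=> [_ [ [b c] [/= /oB ob /oC oc] <-]|[x y] A].
  rewrite openE => -[u v] [/= bu cv]; exists (b, c) => //=.
  by split; exact: open_nbhs_nbhs.
move=> [[P Q]/= [xP yQ] PQA].
have [b [Bb bx] bP] := bB x P xP; have [c [Cc cy] cQ] := bC y Q yQ.
exists (b `*` c); first by split=> //; exists (b, c).
by move=> [u v] [/= /bP Pu /cQ Qv]; exact: PQA.
Qed.

Lemma second_countable_sub (T : topologicalType) (S : set T) :
  @second_countable T -> @second_countable S.
Proof.
move=> [B cB [oB bB]]; exists ((fun b => (set_val : S -> T) @^-1` b) @` B).
  exact: sub_countable (card_image_le _ _) cB.
split=> [_ [b /oB ob <-]|x A]; first by exists b.
move=> [_ [[W oW <-] /= Wx] WA].
have [b [Bb bx] bW] := bB (set_val x) W (open_nbhs_nbhs (conj oW Wx)).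
by exists (set_val @^-1` b); [split=> //; exists b|move=> y /bW; exact: WA].
Qed.

Lemma second_countable_R (R : realType) : @second_countable R.
Proof.
exists ((fun p : rat * rat => `]ratr p.1, ratr p.2[%classic) @` setT).
  by apply: sub_countable (card_image_le _ _) _; exact: countableP.
split=> [_ [p _ <-]|x A]; first exact: interval_open.
move=> /nbhs_ballP[e /= e0 eA].
have /rat_in_itvoo[a /itvP a1] : x - e < x by rewrite ltrBlDr ltrDl.
have /rat_in_itvoo[b /itvP b1] : x < x + e by rewrite ltrDl.
exists `]ratr a, ratr b[%classic.
  by split; [exists (a, b)|rewrite /= in_itv /= a1 b1].
move=> y /=; rewrite in_itv /= => /andP[ay yb]; apply: eA.
rewrite -ball_normE /= ltr_distlC.
by rewrite (lt_trans _ ay) ?a1 // (lt_trans yb) // b1.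
Qed.

Lemma open_preimage_on (T U : topologicalType) (f : T -> U) D B :
  open D -> open B -> (forall x, D x -> {for x, continuous f}) ->
  open (D `&` f @^-1` B).
Proof.
move=> Do Bo fc; rewrite openE => x [Dx Bfx].
by apply: filterI; [exact: open_nbhs_nbhs|apply: (fc x Dx); exact: open_nbhs_nbhs].
Qed.

Lemma initial_continuous_for (T U : topologicalType) (S : set U) (f : T -> S) x :
  {for x, continuous ((set_val : S -> U) \o f)} -> {for x, continuous f}.
Proof.
move=> fc A [_ [[W oW <-] /= Wx] WA].
have fW : nbhs x ((set_val \o f) @^-1` W) by exact/fc/open_nbhs_nbhs.
exact: (@filterS _ (nbhs x) _ _ (f @^-1` A) (fun y => WA (f y)) fW).
Qed.

(** By the intermediate value theorem. *)
Lemma nonvanishing_same_sign (R : realType) (f : R -> R) a b : a <= b ->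
  (forall t, t \in `[a, b] -> {for t, continuous f} /\ f t != 0) ->
  0 < f a * f b.
Proof.
move=> ab fab; rewrite ltNge; apply/negP => f0.
have fc : {within `[a, b], continuous f}.
  apply: continuous_in_subspaceT => t; rewrite inE => tab.
  by have [] := fab t tab.
have [|t tab ft] := @IVT _ f a b 0 ab fc.
  move: f0; rewrite /Num.min /Num.max; case: ltP => fafb f0.
    by apply/andP; split; rewrite leNgt; apply/negP => h; nra.
  by apply/andP; split; rewrite leNgt; apply/negP => h; nra.
by have [_] := fab t tab; rewrite ft eqxx.
Qed.

End Topology.

Section Rows.
Context {R : realType}.

(** Turns facts on row_mx into facts on sums and linear maps. *)
Lemma row_mx_linear n1 n2 (u : 'rV[R]_n1) (v : 'rV[R]_n2) :
  row_mx u v = mulmxr (row_mx 1%:M 0) u + mulmxr (row_mx 0 1%:M) v.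
Proof.
by rewrite /= !mul_mx_row !mulmx1 !mulmx0 add_row_mx addr0 add0r.
Qed.

Lemma continuous_row_mx (T : topologicalType) n1 n2 (f : T -> 'rV[R]_n1)
    (g : T -> 'rV[R]_n2) x : {for x, continuous f} -> {for x, continuous g} ->
  {for x, continuous (fun y => row_mx (f y) (g y))}.
Proof.
move=> fc gc.
have -> : (fun y => row_mx (f y) (g y)) =
    (fun y => mulmxr (row_mx 1%:M 0) (f y) + mulmxr (row_mx 0 1%:M) (g y)).
  by apply/funext => y; exact: row_mx_linear.
apply: cvgD.
  by apply: (@continuous_comp _ _ _ f); [exact: fc|exact: linear_rV_continuous].
by apply: (@continuous_comp _ _ _ g); [exact: gc|exact: linear_rV_continuous].
Qed.

Lemma Cr_row_mx (V : normedModType R) (D : set V) r n1 n2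
    (f : V -> 'rV[R]_n1) (g : V -> 'rV[R]_n2) :
  open D -> Cr D r f -> Cr D r g -> Cr D r (fun x => row_mx (f x) (g x)).
Proof.
move=> Do fr gr; under eq_fun do rewrite row_mx_linear; apply: Cr_add => //.
  by apply: (Cr_linear Do _ fr); exact: linear_rV_continuous.
by apply: (Cr_linear Do _ gr); exact: linear_rV_continuous.
Qed.

Lemma row_jacobian m n (f : 'rV[R]_m -> 'rV[R]_n) a i :
  differentiable f a -> row i ('J f a) = 'D_('e_i) f a.
Proof. by move=> df; rewrite rowE /jacobian mul_rV_lin1 (deriveE _ df). Qed.

Lemma near_eq_jacobian m n (f g : 'rV[R]_m -> 'rV[R]_n) a :
  differentiable f a -> (\near a, f a = g a) -> 'J f a = 'J g a.
Proof.
move=> df fg; have dg := near_eq_differentiable fg df.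
apply/row_matrixP => i.
exact: etrans (row_jacobian i df)
  (etrans (near_eq_derive _ fg) (esym (row_jacobian i dg))).
Qed.

Lemma jacobian_comp m n p (f : 'rV[R]_m -> 'rV[R]_n) (g : 'rV[R]_n -> 'rV[R]_p)
    a : differentiable f a -> differentiable g (f a) ->
  'J (g \o f) a = 'J f a *m 'J g (f a).
Proof.
move=> df dg; apply/row_matrixP => i; rewrite row_mul.
have dgf := diff_comp df dg.
apply: etrans (row_jacobian i (differentiable_comp df dg)) _.
apply: etrans (deriveE _ (differentiable_comp df dg)) _.
apply: etrans (congr1 (fun h => h 'e_i) dgf) _; apply/esym.
have -> : row i ('J f a) = 'd f a 'e_i.
  exact: etrans (row_jacobian i df) (deriveE _ df).
exact: mul_rV_lin1.
Qed.

Lemma jacobian_linear m n (L : {linear 'rV[R]_m -> 'rV[R]_n}) a :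
  'J L a = lin1_mx L.
Proof.
by rewrite /jacobian diff_lin //; exact: linear_rV_continuous.
Qed.

Lemma jacobian_affine m n (A : 'M[R]_(m, n)) (b : 'rV[R]_n) a :
  'J (fun y => y *m A + b) a = A.
Proof.
have dA : differentiable (mulmxr A : 'rV[R]_m -> 'rV[R]_n) a.
  by apply: linear_differentiable; exact: linear_rV_continuous.
have db : differentiable (cst b : 'rV[R]_m -> 'rV[R]_n) a.
  exact: differentiable_cst.
have -> : (fun y => y *m A + b) =
    (mulmxr A : 'rV[R]_m -> 'rV[R]_n) + cst b by apply/funext.
apply/row_matrixP => i; rewrite (row_jacobian i (differentiableD dA db)).
rewrite deriveD; [|exact: diff_derivable|exact: diff_derivable].
rewrite derive_cst addr0 (deriveE _ dA) diff_lin; first by rewrite /= -rowE.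
exact: linear_rV_continuous.
Qed.

End Rows.

(* Conversion must not unfold 'J when two Jacobian matrices are compared. *)
Opaque jacobian.

(** * Charts, products of manifolds and pair groupoids *)

Section Charts.
Context {R : realType} {n : nat} {M : manifold R n}.
Implicit Types (c d : chart M) (U : set M).

Lemma cod_dom c y : (coord c @` dom c) y -> dom c (icoord c y).
Proof. by case=> p cp <-; rewrite coordK. Qed.

Lemma icoordK c y : (coord c @` dom c) y -> coord c (icoord c y) = y.
Proof. by case=> p cp <-; rewrite coordK. Qed.

Lemma image_chartE c U :
  coord c @` (dom c `&` U) = coord c @` dom c `&` icoord c @^-1` U.
Proof.
apply/seteqP; split=> [_ [p [cp Up] <-]|y [cy Uy]].
  by split; [exists p | rewrite /= coordK].
exists (icoord c y); last exact: icoordK.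
by split=> //; exact: cod_dom.
Qed.

Lemma open_image_chart c U : open U -> open (coord c @` (dom c `&` U)).
Proof.
move=> oU; rewrite image_chartE; apply: open_preimage_on => //.
  exact: cod_open.
by move=> y cy; exact: icoord_continuous.
Qed.

Lemma transition_differentiable c d p : dom c p -> dom d p ->
  differentiable (coord d \o icoord c) (coord c p).
Proof.
by move=> cp dp; have [+ _] := @transition_smooth _ _ M c d 1; apply; exists p.
Qed.

Lemma transition_id c p : dom c p ->
  'J (coord c \o icoord c) (coord c p) = 1%:M.
Proof.
move=> cp; have -> : 'J (coord c \o icoord c) (coord c p) =
    'J (@idfun 'rV[R]_n) (coord c p).
  apply: near_eq_jacobian; first exact: transition_differentiable.
  apply: (open_near (@cod_open _ _ M c)); first by exists p.
  by move=> y cy /=; exact: icoordK.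
rewrite jacobian_linear; apply/row_matrixP => i.
by rewrite rowE mul_rV_lin1 /= row1.
Qed.

Lemma transition_comp c d e p : dom c p -> dom d p -> dom e p ->
  'J (coord e \o icoord c) (coord c p) =
  'J (coord d \o icoord c) (coord c p) *m 'J (coord e \o icoord d) (coord d p).
Proof.
move=> cp dp ep.
have E : (coord d \o icoord c) (coord c p) = coord d p by rewrite /= coordK.
have fcd := transition_differentiable cp dp.
have fde : differentiable (coord e \o icoord d) ((coord d \o icoord c) (coord c p)).
  by rewrite E; exact: transition_differentiable.
have oD : open (coord c @` (dom c `&` dom d)).
  by apply: open_image_chart; exact: dom_open.
have ceE : \forall y \near coord c p, (coord e \o icoord c) y =
    ((coord e \o icoord d) \o (coord d \o icoord c)) y.
  apply: (open_near oD); first by exists p.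
  by move=> _ [q [cq dq] <-]; rewrite /= coordK // coordK.
have JE := near_eq_jacobian (transition_differentiable cp ep) ceE.
have JC := jacobian_comp fcd fde.
have JP := congr1 (jacobian (coord e \o icoord d)) E.
exact: etrans JE (etrans JC (congr1 _ JP)).
Qed.

(** The Jacobian matrices of opposite transitions are inverse to each other. *)
Lemma transition_unit c d p : dom c p -> dom d p ->
  'J (coord d \o icoord c) (coord c p) \in unitmx.
Proof.
move=> cp dp; have := transition_comp cp dp cp; rewrite (transition_id cp).
by move=> /esym/mulmx1_unit[+ _].
Qed.

End Charts.

Section SmoothMapTheory.
Context {R : realType}.

Lemma smooth_map_id n (M : manifold R n) : smooth_map (@id M).
Proof.
move=> c; split=> [y cy|d]; first exact: icoord_continuous.
move=> r; apply: Cr_sub (@transition_smooth _ _ M c d r).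
by rewrite image_chartE.
Qed.

Lemma smooth_fun_continuous n (M : manifold R n) (W : normedModType R)
    (U : set M) (f : M -> W) p :
  open U -> smooth_fun U f -> U p -> {for p, continuous f}.
Proof.
move=> oU fs Up; set c := chart_at p; have /= fc := fs c 0%N.
have cp : dom c p by exact: dom_chart_at.
have fE : \near p, (f \o icoord c \o coord c) p = f p.
  apply: filterS (open_nbhs_nbhs (conj (@dom_open _ _ M c) cp)) => q cq.
  by rewrite /= coordK.
apply: near_eq_for_continuous fE _.
apply: continuous_comp; first exact: coord_continuous.
by apply: fc; exists p.
Qed.

End SmoothMapTheory.

Section ProductManifold.
Context {R : realType} {m n : nat} (M : manifold R m) (N : manifold R n).

Let pdom (c : chart M * chart N) : set (M * N) := dom c.1 `*` dom c.2.
Let pcoord (c : chart M * chart N) (p : M * N) : 'rV[R]_(m + n) :=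
  row_mx (coord c.1 p.1) (coord c.2 p.2).
Let picoord (c : chart M * chart N) (y : 'rV[R]_(m + n)) : M * N :=
  (icoord c.1 (lsubmx y), icoord c.2 (rsubmx y)).

Let pcodE c (U : set M) (V : set N) : pcoord c @` (pdom c `&` (U `*` V)) =
  (lsubmx @^-1` (coord c.1 @` (dom c.1 `&` U))) `&`
  (rsubmx @^-1` (coord c.2 @` (dom c.2 `&` V))).
Proof.
apply/seteqP; split=> [_ [p [[p1 p2] [Up Vp]] <-]|y [[p [p1 Up] yp] [q [q2 Vq] yq]]].
  rewrite /pcoord; split=> /=.
    by exists p.1 => //; rewrite row_mxKl.
  by exists p.2 => //; rewrite row_mxKr.
by exists (p, q) => //; rewrite /pcoord /= yp yq hsubmxK.
Qed.

Lemma open_lsub (D : set 'rV[R]_m) :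
  open D -> open ((lsubmx : 'rV[R]_(m + n) -> _) @^-1` D).
Proof. by apply: open_comp => y _; exact: continuous_lsubmx. Qed.

Lemma open_rsub (D : set 'rV[R]_n) :
  open D -> open ((rsubmx : 'rV[R]_(m + n) -> _) @^-1` D).
Proof. by apply: open_comp => y _; exact: continuous_rsubmx. Qed.

Let pcod c : pcoord c @` pdom c =
  (lsubmx @^-1` (coord c.1 @` dom c.1)) `&`
  (rsubmx @^-1` (coord c.2 @` dom c.2)).
Proof.
have := pcodE c setT setT; rewrite !setIT => <-; congr (_ @` _).
by apply/seteqP; split=> p // [].
Qed.

Let phausdorff : hausdorff_space (M * N)%type.
Proof. by apply: hausdorff_prod; exact: manifold_hausdorff. Qed.

Let pcountable : @second_countable (M * N)%type.
Proof. by apply: second_countable_prod; exact: manifold_countable. Qed.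

Let pdom_open c : open (pdom c).
Proof.
rewrite openE => p [/= p1 p2]; exists (dom c.1, dom c.2) => //=.
by split; apply: open_nbhs_nbhs; split=> //; exact: dom_open.
Qed.

Let pcod_open c : open (pcoord c @` pdom c).
Proof.
by rewrite pcod; apply: openI; [apply: open_lsub|apply: open_rsub];
  exact: cod_open.
Qed.

Let pcoordK c p : pdom c p -> picoord c (pcoord c p) = p.
Proof.
case: p => p q [/= cp cq].
by rewrite /picoord /pcoord row_mxKl row_mxKr /= !coordK.
Qed.

Let pcoord_continuous c p : pdom c p -> {for p, continuous (pcoord c)}.
Proof.
move=> [p1 p2]; apply: continuous_row_mx.
  by apply: (@continuous_comp _ _ _ fst); [exact: cvg_fst|exact: coord_continuous].
by apply: (@continuous_comp _ _ _ snd); [exact: cvg_snd|exact: coord_continuous].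
Qed.

Let picoord_continuous c y : (pcoord c @` pdom c) y ->
  {for y, continuous (picoord c)}.
Proof.
rewrite pcod => -[y1 y2].
have h1 : {for y, continuous (icoord c.1 \o lsubmx)}.
  apply: continuous_comp; first exact: continuous_lsubmx.
  exact: icoord_continuous.
have h2 : {for y, continuous (icoord c.2 \o rsubmx)}.
  apply: continuous_comp; first exact: continuous_rsubmx.
  exact: icoord_continuous.
exact: cvg_pair h1 h2.
Qed.

Let ptransition_smooth c d :
  smooth_on (pcoord c @` (pdom c `&` pdom d)) (pcoord d \o picoord c).
Proof.
move=> r; rewrite pcodE.
have o1 : open (coord c.1 @` (dom c.1 `&` dom d.1)).
  by apply: open_image_chart; exact: dom_open.
have o2 : open (coord c.2 @` (dom c.2 `&` dom d.2)).
  by apply: open_image_chart; exact: dom_open.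
have := @transition_smooth _ _ M c.1 d.1 r.
have := @transition_smooth _ _ N c.2 d.2 r.
move=> /(Cr_comp_linear o2 (@continuous_rsubmx _ _ m n)) h2.
move=> /(Cr_comp_linear o1 (@continuous_lsubmx _ _ m n)) h1.
have oD := openI (open_lsub o1) (open_rsub o2).
exact: (Cr_row_mx oD (Cr_sub (@subIsetl _ _ _) h1) (Cr_sub (@subIsetr _ _ _) h2)).
Qed.

Definition prod_manifold : manifold R (m + n) :=
  @Manifold R (m + n) (M * N)%type (chart M * chart N)%type
    pdom pcoord picoord (fun p => (chart_at p.1, chart_at p.2))
    phausdorff pcountable pdom_open pcod_open pcoordK pcoord_continuous
    picoord_continuous (fun p => conj (dom_chart_at p.1) (dom_chart_at p.2))
    ptransition_smooth.

End ProductManifold.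

Section Projections.
Context {R : realType} {m n p : nat}.
Context {M : manifold R m} {N : manifold R n} {P : manifold R p}.

Lemma smooth_fst : smooth_map (fst : prod_manifold M N -> M).
Proof.
move=> [c e]; split=> [y [q [/= q1 _] <-]|d r].
  apply: (@continuous_comp _ _ _ lsubmx); first exact: continuous_lsubmx.
  by rewrite row_mxKl; apply: icoord_continuous; exists q.1.
have o1 : open (coord c @` (dom c `&` dom d)).
  by apply: open_image_chart; exact: dom_open.
apply: (Cr_sub _ (Cr_comp_linear o1 (@continuous_lsubmx _ _ m n)
                   (@transition_smooth _ _ M c d r))).
move=> _ [[q [q1 _] <-]]; rewrite /= row_mxKl coordK //= => dq.
by exists q.1.
Qed.

Lemma smooth_snd : smooth_map (snd : prod_manifold M N -> N).
Proof.
move=> [e c]; split=> [y [q [/= _ q2] <-]|d r].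
  apply: (@continuous_comp _ _ _ rsubmx); first exact: continuous_rsubmx.
  by rewrite row_mxKr; apply: icoord_continuous; exists q.2.
have o1 : open (coord c @` (dom c `&` dom d)).
  by apply: open_image_chart; exact: dom_open.
apply: (Cr_sub _ (Cr_comp_linear o1 (@continuous_rsubmx _ _ m n)
                   (@transition_smooth _ _ N c d r))).
move=> _ [[q [_ q2] <-]]; rewrite /= row_mxKr coordK //= => dq.
by exists q.2.
Qed.

Lemma smooth_pair (f : P -> M) (g : P -> N) : smooth_map f -> smooth_map g ->
  smooth_map (fun x => (f x, g x) : prod_manifold M N).
Proof.
move=> fs gs c; have [fc fr] := fs c; have [gc gr] := gs c.
split=> [y cy|[d e] r]; first exact: cvg_pair (fc y cy) (gc y cy).
have oc : open (coord c @` dom c) by exact: cod_open.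
have o1 := open_preimage_on oc (@dom_open _ _ M d) fc.
have o2 := open_preimage_on oc (@dom_open _ _ N e) gc.
set D := _ `&` _.
have -> : D = (coord c @` dom c `&` (f \o icoord c) @^-1` dom d) `&`
    (coord c @` dom c `&` (g \o icoord c) @^-1` dom e).
  by apply/seteqP; split=> y; [move=> [cy [? ?]]|move=> [[cy ?] [_ ?]]].
exact: (Cr_row_mx (openI o1 o2) (Cr_sub (@subIsetl _ _ _) (fr d r))
  (Cr_sub (@subIsetr _ _ _) (gr e r))).
Qed.

Lemma tmx_fst q : tmx (fst : prod_manifold M N -> M) q = lin1_mx lsubmx.
Proof.
set f := fst; set c := chart_at q.1.
have cq : dom c q.1 by exact: dom_chart_at.
pose y := coord (chart_at q) q.
have yE : \forall z \near y, lsubmx z = (coord c \o f \o icoord (chart_at q)) z.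
  apply: (open_near (@cod_open _ _ (prod_manifold M N) (chart_at q))).
    by exists q => //; exact: dom_chart_at.
  by move=> _ [z [z1 _] <-]; rewrite /= row_mxKl coordK.
apply: etrans (esym (near_eq_jacobian _ yE)) _.
  exact: differentiable_lsubmx.
exact: jacobian_linear.
Qed.

Lemma tmx_snd q : tmx (snd : prod_manifold M N -> N) q = lin1_mx rsubmx.
Proof.
set f := snd; set c := chart_at q.2.
have cq : dom c q.2 by exact: dom_chart_at.
pose y := coord (chart_at q) q.
have yE : \forall z \near y, rsubmx z = (coord c \o f \o icoord (chart_at q)) z.
  apply: (open_near (@cod_open _ _ (prod_manifold M N) (chart_at q))).
    by exists q => //; exact: dom_chart_at.
  by move=> _ [z [_ z2] <-]; rewrite /= row_mxKr coordK.
apply: etrans (esym (near_eq_jacobian _ yE)) _.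
  exact: differentiable_rsubmx.
exact: jacobian_linear.
Qed.

Lemma submersion_fst : submersion (fst : prod_manifold M N -> M).
Proof.
split=> [|q]; first exact: smooth_fst.
rewrite tmx_fst; apply/eqP/row_fullP; exists (row_mx 1%:M 0).
apply/row_matrixP => i.
by rewrite row_mul mul_rV_lin1 row_row_mx /= row_mxKl.
Qed.

Lemma submersion_snd : submersion (snd : prod_manifold M N -> N).
Proof.
split=> [|q]; first exact: smooth_snd.
rewrite tmx_snd; apply/eqP/row_fullP; exists (row_mx 0 1%:M).
apply/row_matrixP => i.
by rewrite row_mul mul_rV_lin1 row_row_mx /= row_mxKr.
Qed.

(** In product charts the differential of a transition is block diagonal. *)
Lemma tcoord_prod (d : chart M) (e : chart N) (q : prod_manifold M N) w :
  dom d q.1 -> dom e q.2 ->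
  @tcoord _ _ (prod_manifold M N) (d, e) q w =
  row_mx (tcoord d q.1 (lsubmx w)) (tcoord e q.2 (rsubmx w)).
Proof.
move=> dq eq; rewrite /tcoord.
set F := @coord _ _ (prod_manifold M N) (d, e) \o _; set y := coord (chart_at q) q.
set f := coord d \o _; set g := coord e \o _.
have dF : differentiable F y.
  exact: (@transition_differentiable _ _ (prod_manifold M N) (chart_at q) (d, e)
    q (dom_chart_at q) (conj dq eq)).
have ly : lsubmx y = coord (chart_at q.1) q.1 by rewrite /y /= row_mxKl.
have ry : rsubmx y = coord (chart_at q.2) q.2 by rewrite /y /= row_mxKr.
have df : differentiable f (lsubmx y).
  by rewrite ly; exact: transition_differentiable (dom_chart_at q.1) dq.
have dg : differentiable g (rsubmx y).
  by rewrite ry; exact: transition_differentiable (dom_chart_at q.2) eq.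
have FlE : lsubmx \o F = f \o lsubmx.
  by apply/funext => z; rewrite /= row_mxKl.
have FrE : rsubmx \o F = g \o rsubmx.
  by apply/funext => z; rewrite /= row_mxKr.
have JlE : 'J F y *m lin1_mx lsubmx = lin1_mx lsubmx *m 'J f (lsubmx y).
  have h1 := jacobian_comp dF (@differentiable_lsubmx _ 1 m n (F y)).
  have h2 := jacobian_comp (@differentiable_lsubmx _ 1 m n y) df.
  have h3 := congr1 (fun h => jacobian h y) FlE.
  have j1 := congr1 (mulmx ('J F y)) (@jacobian_linear _ _ _ lsubmx (F y)).
  have j2 := congr1 (fun A => A *m 'J f (lsubmx y)) (@jacobian_linear _ _ _ lsubmx y).
  exact: etrans (esym j1) (etrans (esym h1) (etrans h3 (etrans h2 j2))).
have JrE : 'J F y *m lin1_mx rsubmx = lin1_mx rsubmx *m 'J g (rsubmx y).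
  have h1 := jacobian_comp dF (@differentiable_rsubmx _ 1 m n (F y)).
  have h2 := jacobian_comp (@differentiable_rsubmx _ 1 m n y) dg.
  have h3 := congr1 (fun h => jacobian h y) FrE.
  have j1 := congr1 (mulmx ('J F y)) (@jacobian_linear _ _ _ rsubmx (F y)).
  have j2 := congr1 (fun A => A *m 'J g (rsubmx y)) (@jacobian_linear _ _ _ rsubmx y).
  exact: etrans (esym j1) (etrans (esym h1) (etrans h3 (etrans h2 j2))).
rewrite -[LHS]hsubmxK -ly -ry; congr row_mx.
  rewrite -[LHS](mul_rV_lin1 lsubmx) -mulmxA JlE mulmxA.
  have lw : w *m lin1_mx lsubmx = lsubmx w by exact: mul_rV_lin1.
  have lJ := congr1 (fun v : 'rV[R]_m => v *m 'J f (lsubmx y)) lw.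
  exact: lJ.
rewrite -[LHS](mul_rV_lin1 rsubmx) -mulmxA JrE mulmxA.
have rw : w *m lin1_mx rsubmx = rsubmx w by exact: mul_rV_lin1.
have rJ := congr1 (fun v : 'rV[R]_n => v *m 'J g (rsubmx y)) rw.
exact: rJ.
Qed.

End Projections.

Section PairGroupoid.
Context {R : realType} {n : nat} (M : manifold R n).

Let MM := prod_manifold M M.
Let pmul (g h : MM) : MM := (g.1, h.2).

Let pmul_smooth (g h : MM) : g.2 = h.1 ->
    exists (D : set ('rV[R]_(n + n) * 'rV[R]_(n + n)))
           (F : 'rV[R]_(n + n) * 'rV[R]_(n + n) -> 'rV[R]_(n + n)),
      [/\ open D, D (coord (chart_at g) g, coord (chart_at h) h),
          smooth_on D F &
          \forall z \near (g, h), z.1.2 = z.2.1 ->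
            dom (chart_at (pmul g h)) (pmul z.1 z.2) /\
            F (coord (chart_at g) z.1, coord (chart_at h) z.2) =
              coord (chart_at (pmul g h)) (pmul z.1 z.2)].
Proof.
move=> _; exists setT, (fun z => row_mx (lsubmx z.1) (rsubmx z.2)); split=> //.
- exact: openT.
- move=> r.
  have hl := Cr_linear openT (@continuous_lsubmx _ _ n n)
    (@Cr_id _ 'rV[R]_(n + n) setT r).
  have hr := Cr_linear openT (@continuous_rsubmx _ _ n n)
    (@Cr_id _ 'rV[R]_(n + n) setT r).
  have fc : continuous (@fst 'rV[R]_(n + n) 'rV[R]_(n + n)).
    by move=> z; exact: cvg_fst.
  have sc : continuous (@snd 'rV[R]_(n + n) 'rV[R]_(n + n)).
    by move=> z; exact: cvg_snd.
  exact: (Cr_row_mx openT (Cr_comp_linear openT fc hl)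
    (Cr_comp_linear openT sc hr)).
have g1 : nbhs g.1 (dom (chart_at g.1)).
  by apply: open_nbhs_nbhs; split; [exact: dom_open|exact: dom_chart_at].
have h2 : nbhs h.2 (dom (chart_at h.2)).
  by apply: open_nbhs_nbhs; split; [exact: dom_open|exact: dom_chart_at].
exists ((fst : MM -> M) @^-1` dom (chart_at g.1),
        (snd : MM -> M) @^-1` dom (chart_at h.2)) => /=.
  split; first exact: (@cvg_fst _ _ (nbhs g.1) (nbhs g.2) _).
  exact: (@cvg_snd _ _ (nbhs h.1) (nbhs h.2) _).
move=> [z w] [/= z1 w2] _; split=> //.
by rewrite row_mxKl row_mxKr.
Qed.

Definition pair_groupoid : lieGroupoid n M :=
  @LieGroupoid R n n M MM snd fst (fun x => (x, x)) (fun g => (g.2, g.1)) pmul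
    (fun=> erefl) (fun=> erefl) (fun _ _ _ => erefl) (fun _ _ _ => erefl)
    (fun _ _ _ _ _ => erefl)
    (fun g => esym (surjective_pairing g)) (fun g => esym (surjective_pairing g))
    (fun=> erefl) (fun=> erefl) (fun=> erefl) (fun=> erefl)
    submersion_snd submersion_fst
    (smooth_pair (@smooth_map_id _ _ M) (@smooth_map_id _ _ M))
    (smooth_pair (@smooth_snd _ _ _ M M) (@smooth_fst _ _ _ M M)) pmul_smooth.

End PairGroupoid.

(** * The line bundle Q_A of a pair groupoid *)

Section LinesOfPairs.
Context {R : realType} {n : nat} {M : manifold R n}.
Local Notation G := (pair_groupoid M).
Implicit Types (x : M) (a : 'M[R]_(n, n + n)) (e : 'M[R]_n).

Lemma mulmx_lin1_rsubmx k (A : 'M[R]_(k, n + n)) :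
  A *m lin1_mx rsubmx = rsubmx A.
Proof.
apply/row_matrixP => i; rewrite row_mul mul_rV_lin1 /=.
by apply/rowP => j; rewrite !mxE.
Qed.

(** The fibers of s are the slices M x {x}, so that A_x consists of the
    vectors tangent to the first factor. *)
Lemma basis_pairE x a : basis_mx (algd G x) a =
  (lsubmx a \in unitmx) && (rsubmx a == 0).
Proof.
have kE k (A : 'M[R]_(k, n + n)) : (A <= algd G x)%MS = (rsubmx A == 0).
  by rewrite /algd /= tmx_snd; apply/sub_kermxP/eqP; rewrite mulmx_lin1_rsubmx.
rewrite /basis_mx kE; apply/idP/idP.
  move=> /andP[/row_freeP[B aB] /andP[a0 _]]; rewrite a0 andbT.
  move: aB; rewrite -[a]hsubmxK -[B]vsubmxK mul_row_col (eqP a0) mul0mx addr0.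
  by rewrite row_mxKl => /mulmx1_unit[+ _].
move=> /andP[au a0]; rewrite a0 /=.
have aE : a = row_mx (lsubmx a) 0 by rewrite -(eqP a0) hsubmxK.
apply/andP; split.
  apply/row_freeP; exists (col_mx (invmx (lsubmx a)) 0).
  by rewrite aE mul_row_col row_mxKl mulmxV // mul0mx addr0.
have : (algd G x <= algd G x)%MS by exact: submx_refl.
rewrite kE => /eqP r0; apply/submxP.
exists (lsubmx (algd G x) *m invmx (lsubmx a)).
rewrite {2}aE mul_mx_row mulmx0 mulmxKV // -r0.
by rewrite hsubmxK.
Qed.

Lemma fiberQ_mul x q a e P : fiberQ G x q -> basis_mx (algd G x) a ->
  e \in unitmx -> P \in unitmx ->
  q (P *m a) (P *m e) = (\det P)^-1 * `|\det P| * q a e.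
Proof.
move=> [X [mu [[XP _] [muP _] ->]]] ba eu Pu; rewrite /tensor XP // muP //.
by rewrite mulrACA.
Qed.

(** Q_A has rank one, so that an element of a fiber is determined by its value on
    a single pair of bases. *)
Lemma fiberQ_eq0 x q a e : fiberQ G x q -> basis_mx (algd G x) a ->
  e \in unitmx -> q a e = 0 -> q = fun _ _ => 0.
Proof.
move=> [X [mu [[XP X0] [muP mu0] ->]]] ba eu; rewrite /tensor => qae.
apply/funext => b; apply/funext => f.
have [bb|/X0->] := boolP (basis_mx (algd G x) b); last by rewrite mul0r.
have [fu|/mu0->] := boolP (f \in unitmx); last by rewrite mulr0.
have fE : f = (f *m invmx e) *m e by rewrite mulmxKV.
have bE : b = (lsubmx b *m invmx (lsubmx a)) *m a.
  move: ba bb; rewrite !basis_pairE => /andP[au /eqP a0] /andP[bu /eqP b0].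
  rewrite -{2}[a]hsubmxK a0 mul_mx_row mulmx0 mulmxKV // -b0.
  by rewrite hsubmxK.
have Pu : lsubmx b *m invmx (lsubmx a) \in unitmx.
  move: ba bb; rewrite !basis_pairE => /andP[au _] /andP[bu _].
  by rewrite unitmx_mul bu unitmx_inv.
have Qu : f *m invmx e \in unitmx by rewrite unitmx_mul fu unitmx_inv.
by rewrite bE fE XP // muP // mulrACA qae mulr0.
Qed.

End LinesOfPairs.

Section ChartFrames.
Context {R : realType} {n : nat} {M : manifold R n}.
Local Notation G := (pair_groupoid M).

(** The rows are the coordinate fields of the chart c, written in the preferred
    chart at x as the representation of tangent vectors demands. *)
Definition chart_frameT (c : chart M) (x : M) : 'M[R]_n :=
  'J (coord (chart_at x) \o icoord c) (coord c x).

Definition chart_frameA (c : chart M) (x : M) : 'M[R]_(n, n + n) :=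
  row_mx (chart_frameT c x) 0.

Lemma chart_frameT_unit c x : dom c x -> chart_frameT c x \in unitmx.
Proof. by move=> cx; apply: transition_unit (dom_chart_at x). Qed.

Lemma chart_frameA_basis c x : dom c x ->
  basis_mx (algd G x) (chart_frameA c x).
Proof.
move=> cx; rewrite basis_pairE row_mxKl row_mxKr eqxx andbT.
exact: chart_frameT_unit.
Qed.

Lemma tcoord_chart_frame c d x i : dom c x -> dom d x ->
  tcoord d x (row i (chart_frameT c x)) =
  row i ('J (coord d \o icoord c) (coord c x)).
Proof.
move=> cx dx; rewrite /tcoord -row_mul; congr row.
exact: esym (transition_comp cx (dom_chart_at x) dx).
Qed.

(** In coordinates of d the fields of c are the rows of the Jacobian matrix of the
    transition from c to d, that is, its partial derivatives; they are read at a
    point given in a third chart c'. *)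
Lemma smooth_tcoord_chart_frame c c' d i :
  smooth_on (coord c' @` (dom c' `&` (dom c `&` dom d)))
    (fun y => tcoord d (icoord c' y) (row i (chart_frameT c (icoord c' y)))).
Proof.
move=> r; set D := _ @` _.
have oD : open D.
  by apply: open_image_chart; apply: openI; exact: dom_open.
have oE : open (coord c @` (dom c `&` dom d)).
  by apply: open_image_chart; exact: dom_open.
apply: (Cr_ext oD (f := fun y =>
  'D_('e_i) (coord d \o icoord c) ((coord c \o icoord c') y))).
  move=> _ [x [c'x [cx dx]] <-]; rewrite coordK // tcoord_chart_frame //.
  have dJ := row_jacobian i (transition_differentiable cx dx).
  by rewrite /= coordK //; exact: esym dJ.
apply: Cr_rV => // j; have [_ /(_ 'e_i) h] := @transition_smooth _ _ M c d r.+1.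
apply: (Cr_comp (f := fun z => 'D_('e_i) (coord d \o icoord c) z ord0 j)
          oD _ (Cr_coord j oE h) _).
  by move=> _ [x [c'x [cx dx]] <-]; rewrite /= coordK //; exists x.
apply: Cr_sub (@transition_smooth _ _ M c' c r).
by move=> _ [x [c'x [cx dx]] <-]; exists x.
Qed.

Lemma chart_frameT_frame c : frameT (dom c) (chart_frameT c).
Proof.
split=> [|x|i c' d r]; [exact: dom_open|exact: chart_frameT_unit|].
have -> : dom c' `&` dom c `&` id @^-1` dom d = dom c' `&` (dom c `&` dom d).
  by rewrite setIA.
exact: smooth_tcoord_chart_frame.
Qed.

Lemma chart_frameA_frame c : frameA G (dom c) (chart_frameA c).
Proof.
split=> [|x|i c' [d e] r]; [exact: dom_open|exact: chart_frameA_basis|].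
set D := _ @` _.
have oDE : open (dom c `&` (dom d `&` dom e)).
  by apply: openI; [|apply: openI]; exact: dom_open.
have DE : D = coord c' @` (dom c' `&` (dom c `&` (dom d `&` dom e))).
  by rewrite /D -setIA.
have oD : open D by rewrite DE; exact: open_image_chart.
have h := @smooth_tcoord_chart_frame c c' d i r.
have h0 : Cr D r (cst 0 : 'rV[R]_n -> 'rV[R]_n) by exact: Cr_cst.
have hD : Cr D r (fun y =>
    tcoord d (icoord c' y) (row i (chart_frameT c (icoord c' y)))).
  by apply: Cr_sub h; rewrite DE => _ [x [c'x [cx [dx _]]] <-]; exists x.
apply: (Cr_ext oD _ (Cr_row_mx oD hD h0)).
rewrite DE => _ [x [c'x [cx [dx ex]]] <-].
rewrite coordK // [RHS]tcoord_prod //= row_row_mx row_mxKl row_mxKr.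
by congr row_mx; rewrite row0 /tcoord mul0mx.
Qed.

End ChartFrames.

Section ChartSection.
Context {R : realType} {n : nat} {M : manifold R n} (c : chart M).
Local Notation G := (pair_groupoid M).

Let T (x : M) : 'M[R]_n :=
  'J (coord c \o icoord (chart_at x)) (coord (chart_at x) x).

Let Tunit x : dom c x -> T x \in unitmx.
Proof. by move=> cx; apply: transition_unit (dom_chart_at x) cx. Qed.

(** The section of Q_A whose coefficient in the frames of the chart c is 1;
    multiplication by [T x] converts a basis at x to the coordinates of c. *)
Definition chart_section (x : M) : 'M[R]_(n, n + n) -> 'M[R]_n -> R :=
  tensor
    (fun a => if basis_mx (algd G x) a then (\det (lsubmx a *m T x))^-1 else 0)
    (fun e => `|\det (e *m T x)|).

Lemma chart_sectionE x a e : basis_mx (algd G x) a -> chart_section x a e =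
  (\det (lsubmx a *m T x))^-1 * `|\det (e *m T x)|.
Proof. by rewrite /chart_section /tensor => ->. Qed.

Lemma chart_section_fiber x : fiberQ G x (chart_section x).
Proof.
rewrite /chart_section; do 2 eexists; split; last by [].
- split=> [a P ba Pu|a /negbTE -> //].
  have -> : basis_mx (algd G x) (P *m a).
    move: ba; rewrite !basis_pairE -mulmx_lsub -mulmx_rsub.
    by move=> /andP[au /eqP ->]; rewrite mulmx0 eqxx unitmx_mul Pu au.
  by rewrite ba -mulmx_lsub -mulmxA det_mulmx invfM.
- split=> [e P eu Pu|e]; first by rewrite -mulmxA det_mulmx normrM.
  by rewrite unitmxE unitfE negbK det_mulmx => /eqP ->; rewrite mul0r normr0.
Qed.

Lemma chart_section_neq0 x a e : dom c x -> basis_mx (algd G x) a ->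
  e \in unitmx -> chart_section x a e != 0.
Proof.
move=> cx ba eu; rewrite chart_sectionE // mulf_neq0 //.
  rewrite invr_eq0 -unitfE -unitmxE unitmx_mul Tunit // andbT.
  by move: ba; rewrite basis_pairE => /andP[].
by rewrite normr_eq0 -unitfE -unitmxE unitmx_mul Tunit // eu.
Qed.

Lemma chart_section_smooth : sectionQ G (dom c) chart_section.
Proof.
split=> [x _|V a e [oV ba aS] [_ eu eS] c' r]; first exact: chart_section_fiber.
set D := _ @` _.
have oD : open D.
  by apply: open_image_chart; apply: openI => //; exact: dom_open.
have DP y : D y -> [/\ dom c' (icoord c' y), dom c (icoord c' y) &
    V (icoord c' y)].
  by move=> [x [c'x [cx Vx]] <-]; rewrite coordK.
have hA : Cr D r (fun y =>
    \det (lsubmx (a (icoord c' y)) *m T (icoord c' y))).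
  apply: Cr_det => // i j.
  have h : Cr D r (fun y => @tcoord _ _ (prod_manifold M M) (c, c)
      (icoord c' y, icoord c' y) (row i (a (icoord c' y)))).
    apply: Cr_sub (aS i c' (c, c) r) => _ [x [c'x [cx Vx]] <-].
    by exists x.
  have hl := Cr_coord j oD (Cr_linear oD (@continuous_lsubmx _ _ n n) h).
  apply: (Cr_ext oD _ hl) => y /DP[_ cx _].
  rewrite /= tcoord_prod // row_mxKl /tcoord /= -/(T _).
  by rewrite !mxE; apply: eq_bigr => k _; rewrite !mxE.
have hE : Cr D r (fun y => \det (e (icoord c' y) *m T (icoord c' y))).
  apply: Cr_det => // i j.
  have h : Cr D r (fun y => tcoord c (icoord c' y) (row i (e (icoord c' y)))).
    apply: Cr_sub (eS i c' c r) => _ [x [c'x [cx Vx]] <-].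
    by exists x.
  apply: (Cr_ext oD _ (Cr_coord j oD h)) => y _.
  by rewrite /tcoord -row_mul mxE.
have nA y : D y -> \det (lsubmx (a (icoord c' y)) *m T (icoord c' y)) != 0.
  move=> /DP[_ cx Vx]; rewrite -unitfE -unitmxE unitmx_mul Tunit // andbT.
  by have := ba _ Vx; rewrite basis_pairE => /andP[].
have nE y : D y -> \det (e (icoord c' y) *m T (icoord c' y)) != 0.
  by move=> /DP[_ cx Vx]; rewrite -unitfE -unitmxE unitmx_mul Tunit // eu.
apply: (Cr_ext oD _ (Cr_mul oD (Cr_inv oD nA hA) (Cr_norm oD nE hE))).
by move=> y /DP[_ _ Vx]; rewrite /= chart_sectionE //; exact: ba.
Qed.

End ChartSection.

(** An orientation given by a continuous choice of sign for each chart, up to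
    positive factors: the signs of two charts agree where their transition
    preserves orientation and differ where it reverses it. *)
Definition orientable (R : realType) (n : nat) (M : manifold R n) : Prop :=
  exists h : chart M -> M -> R,
    (forall c x, dom c x -> {for x, continuous (h c)}) /\
    (forall c d x, dom c x -> dom d x ->
       0 < h c x * h d x * \det 'J (coord d \o icoord c) (coord c x)).

Section Orientation.
Context {R : realType} {n : nat} {M : manifold R n}.
Local Notation G := (pair_groupoid M).

(** The transported section q x = Theta (x, x0) s0 vanishes nowhere because the
    arrow (x0, x) brings it back to s0; its coefficients in the chart frames
    orient M. *)
Lemma pair_representation_orientable (x0 : M) Theta :
  is_representation G Theta -> orientable M.
Proof.
move=> [Thfib Thlin Thunt Thmul Thsmooth].
pose c0 := chart_at x0; pose s0 := chart_section c0 x0.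
have c0x0 : dom c0 x0 by exact: dom_chart_at.
have s0Q : fiberQ G x0 s0 by exact: chart_section_fiber.
pose q x := Theta ((x, x0) : G) s0.
have qQ x : fiberQ G x (q x) by exact: (Thfib ((x, x0) : G) s0 s0Q).
pose h c x := q x (chart_frameA c x) (chart_frameT c x).
have h0 c x : dom c x -> h c x != 0.
  move=> cx; apply/eqP => hcx.
  have q0 := fiberQ_eq0 (qQ x) (chart_frameA_basis cx) (chart_frameT_unit cx) hcx.
  have Th0 : Theta ((x0, x) : G) (fun _ _ => 0) = fun _ _ => 0.
    have zQ : fiberQ G x (fun _ _ => 0) by rewrite -q0; exact: qQ.
    apply/funext => a; apply/funext => e.
    have zE : (fun _ _ => -1 * 0 + 0) =
        (fun _ _ => 0) :> ('M[R]_(n, n + n) -> 'M[R]_n -> R).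
      by apply/funext => b; apply/funext => f; rewrite mulr0 addr0.
    have := Thlin ((x0, x) : G) (-1) _ _ zQ zQ a e; rewrite zE => ->.
    by rewrite mulN1r addNr.
  have := Thmul ((x0, x) : G) ((x, x0) : G) s0 erefl s0Q.
  rewrite -/(q x) q0 Th0 => ThE.
  have s0E : s0 = fun _ _ => 0 by rewrite -ThE -[LHS](Thunt _ _ s0Q).
  have := chart_section_neq0 c0x0 (chart_frameA_basis c0x0)
    (chart_frameT_unit c0x0).
  by rewrite -/s0 s0E eqxx.
exists h; split=> [c x cx|c d x cx dx].
  have oc0 := @dom_open _ _ M c0; have oc := @dom_open _ _ M c.
  have := Thsmooth _ _ _ _ _ oc0 (chart_section_smooth c0)
    (chart_frameA_frame c) (chart_frameT_frame c).
  have oW : open ((snd : prod_manifold M M -> M) @^-1` dom c0 `&`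
      (fst : prod_manifold M M -> M) @^-1` dom c).
    apply: openI.
      by apply: open_comp => // z _; exact: cvg_snd.
    by apply: open_comp => // z _; exact: cvg_fst.
  move=> /(smooth_fun_continuous (M := prod_manifold M M) (p := (x, x0)) oW).
  move=> /(_ (conj c0x0 cx)) hc.
  have pc : {for x, continuous (fun y : M => (y, x0) : prod_manifold M M)}.
    by apply: cvg_pair; [exact: cvg_id|exact: cvg_cst].
  exact: (continuous_comp pc hc).
pose P := 'J (coord d \o icoord c) (coord c x).
have Pu : P \in unitmx by exact: transition_unit.
have eE : chart_frameT c x = P *m chart_frameT d x.
  exact: transition_comp cx dx (dom_chart_at x).
have aE : chart_frameA c x = P *m chart_frameA d x.
  by rewrite /chart_frameA mul_mx_row mulmx0 eE.
have hE : h c x = (\det P)^-1 * `|\det P| * h d x.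
  exact: etrans (congr2 (q x) aE eE) (fiberQ_mul (qQ x)
    (chart_frameA_basis dx) (chart_frameT_unit dx) Pu).
have dP : \det P != 0 by rewrite -unitfE -unitmxE.
rewrite -/P hE.
have -> : (\det P)^-1 * `|\det P| * h d x * h d x * \det P =
   `|\det P| * h d x ^+ 2.
  by rewrite mulrC !mulrA mulfV // mul1r.
by rewrite mulr_gt0 ?normr_gt0 // exprn_even_gt0 //= h0.
Qed.

End Orientation.

(** * The Moebius band *)

Section Mobius.
Context {R : realType}.

Definition row2 (a b : R) : 'rV[R]_2 := a *: 'e_0 + b *: 'e_1.

Lemma row2E a b : (row2 a b 0 0 = a) * (row2 a b 0 1 = b).
Proof. by split; rewrite !mxE /= ?mulr1 ?mulr0 ?addr0 ?add0r. Qed.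

Lemma row2P (u v : 'rV[R]_2) : u 0 0 = v 0 0 -> u 0 1 = v 0 1 -> u = v.
Proof.
move=> uv0 uv1; apply/rowP => -[[|[|//]] i].
  by rewrite (_ : Ordinal i = 0) //; exact: val_inj.
by rewrite (_ : Ordinal i = 1) //; exact: val_inj.
Qed.

Local Notation R4 := ((R * R) * (R * R))%type.

(** A copy of the Moebius band in R^4, with coordinates ((p, r), (s, w)).  The
    equation |r| = p (1 - p) says that (p, r) lies on a circle made of two arcs of
    parabolas meeting at p = 0 and at p = 1; the other two equations are linear in
    (s, w) and cut out the line of the band over (p, r).  Being a subset of R^4,
    the band is Hausdorff and second countable. *)
Definition mobius_set : set R4 :=
  [set z | [/\ `|z.1.2| = z.1.1 * (1 - z.1.1),
              (1 - z.1.1) ^+ 2 * z.2.2 = z.1.2 * z.2.1 &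
              z.1.1 ^+ 2 * z.2.1 = z.1.2 * z.2.2]].

(** The strip |x| < 1 is the part p <> 1 of the band, with inverse [flat]. *)
Definition strip (y : 'rV[R]_2) : R4 :=
  ((`|y 0 0|, (1 - `|y 0 0|) * y 0 0), ((1 - `|y 0 0|) * y 0 1, y 0 0 * y 0 1)).

Definition flat (z : R4) : 'rV[R]_2 :=
  row2 (z.1.2 / (1 - z.1.1)) (z.2.1 / (1 - z.1.1)).

Lemma flatE z : (flat z 0 0 = z.1.2 / (1 - z.1.1)) *
  (flat z 0 1 = z.2.1 / (1 - z.1.1)).
Proof. by split; rewrite row2E. Qed.

(** The map (p, r, s, w) -> (1 - p, - r, w, - s) covers the half turn of the
    circle and preserves the band; it carries the strip around p = 1 to the strip
    around p = 0, so that both charts are [flat] up to this turn. *)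
Definition turn (b : bool) (z : R4) : R4 :=
  if b then z else ((1 - z.1.1, - z.1.2), (z.2.2, - z.2.1)).

Definition unturn (b : bool) (z : R4) : R4 :=
  if b then z else ((1 - z.1.1, - z.1.2), (- z.2.2, z.2.1)).

Lemma turnK b : cancel (turn b) (unturn b).
Proof. by case: b => -[[p r] [s w]] //=; rewrite !opprK subKr. Qed.

Lemma unturnK b : cancel (unturn b) (turn b).
Proof. by case: b => -[[p r] [s w]] //=; rewrite !opprK subKr. Qed.

Lemma mobius_turn b z : mobius_set z -> mobius_set (turn b z).
Proof.
case: b z => -[[p r] [s w]] //= [/= rE wE sE]; split=> /=.
- by rewrite normrN rE; ring.
- by rewrite subKr mulrN sE; ring.
- by rewrite wE; ring.
Qed.

Lemma mobius_unturn b z : mobius_set z -> mobius_set (unturn b z).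
Proof.
case: b z => -[[p r] [s w]] //= [/= rE wE sE]; split=> /=.
- by rewrite normrN rE; ring.
- by rewrite subKr sE; ring.
- by rewrite mulrN wE; ring.
Qed.

Lemma mobius_bounds z : mobius_set z -> 0 <= z.1.1 <= 1.
Proof.
case: z => -[p r] [s w] [/= rE _ _].
have := normr_ge0 r; rewrite rE => p0.
by apply/andP; split; nra.
Qed.

Lemma strip_mobius (y : 'rV[R]_2) : `|y 0 0| <= 1 -> mobius_set (strip y).
Proof.
move=> y1; split=> /=.
- by rewrite normrM ger0_norm ?subr_ge0 // mulrC.
- by ring.
- by rewrite -normrX ger0_norm ?sqr_ge0 //; ring.
Qed.

Lemma flat_bound z : mobius_set z -> z.1.1 != 1 -> `|flat z 0 0| = z.1.1.
Proof.
move=> Sz z1; have /andP[z0] := mobius_bounds Sz; rewrite le_eqVlt (negbTE z1).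
move=> /= zlt1; have [rE _ _] := Sz.
have d0 : 0 < 1 - z.1.1 by rewrite subr_gt0.
by rewrite row2E normrM normfV rE (gtr0_norm d0) mulfK // gt_eqF.
Qed.

Lemma flatK z : mobius_set z -> z.1.1 != 1 -> strip (flat z) = z.
Proof.
move=> Sz z1; rewrite /strip flat_bound // !row2E.
have d0 : 1 - z.1.1 != 0 by rewrite subr_eq0 eq_sym.
case: z Sz z1 d0 => -[p r] [s w] [/= _ wE _] _ d0.
congr ((_, _), (_, _)); [by rewrite mulrC divfK|by rewrite mulrC divfK|].
by rewrite mulf_div -wE expr2 mulrC mulKf // mulf_neq0.
Qed.

Lemma stripK (y : 'rV[R]_2) : `|y 0 0| < 1 -> flat (strip y) = y.
Proof.
move=> y1; have d0 : 1 - `|y 0 0| != 0 by rewrite subr_eq0 gt_eqF.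
by apply: row2P; rewrite row2E /= mulrC mulKf.
Qed.

Definition scale_snd (e : R) (y : 'rV[R]_2) : 'rV[R]_2 :=
  y *m diag_mx (row2 1 e).

Lemma scale_sndE e y : (scale_snd e y 0 0 = y 0 0) * (scale_snd e y 0 1 = y 0 1 * e).
Proof. by split; rewrite /scale_snd mul_mx_diag [LHS]mxE row2E ?mulr1. Qed.

(** On the overlap, where x is not 0, the two strips are glued by a
    translation of x by -1 or 1, and y changes sign on exactly one of the two
    components. *)
Lemma flat_turn (y : 'rV[R]_2) : y 0 0 != 0 ->
  flat (turn false (strip y)) =
  scale_snd (Num.sg (y 0 0)) y + row2 (- Num.sg (y 0 0)) 0.
Proof.
move=> y0; have n0 : `|y 0 0| != 0 by rewrite normr_eq0.
have sE : y 0 0 / `|y 0 0| = Num.sg (y 0 0).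
  by rewrite {1}[y 0 0]numEsg mulfK.
apply: row2P; rewrite flatE [RHS]mxE scale_sndE row2E /= subKr.
  by rewrite mulrBl mul1r opprB mulrBl sE [`|_| * _]mulrC mulfK.
by rewrite addr0 mulrAC sE mulrC.
Qed.

Lemma flat_unturn (y : 'rV[R]_2) : y 0 0 != 0 ->
  flat (unturn false (strip y)) =
  scale_snd (- Num.sg (y 0 0)) y + row2 (- Num.sg (y 0 0)) 0.
Proof.
move=> y0; have n0 : `|y 0 0| != 0 by rewrite normr_eq0.
have sE : y 0 0 / `|y 0 0| = Num.sg (y 0 0).
  by rewrite {1}[y 0 0]numEsg mulfK.
apply: row2P; rewrite flatE [RHS]mxE scale_sndE row2E /= subKr.
  by rewrite mulrBl mul1r opprB mulrBl sE [`|_| * _]mulrC mulfK.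
by rewrite addr0 mulNr mulrAC sE mulrN mulrC.
Qed.

End Mobius.

Section MobiusManifold.
Context {R : realType}.

Local Notation R4 := ((R * R) * (R * R))%type.
Let S : set R4 := mobius_set.

Lemma row2_continuous (T : topologicalType) (f g : T -> R) x :
  {for x, continuous f} -> {for x, continuous g} ->
  {for x, continuous (fun y => row2 (f y) (g y))}.
Proof. by move=> fc gc; exact: cvgD (cvgZr_tmp fc) (cvgZr_tmp gc). Qed.

Let pc (z : R4) : {for z, continuous (fun z : R4 => z.1.1)}.
Proof. exact: (@continuous_comp _ _ _ fst fst z cvg_fst cvg_fst). Qed.
Let rc (z : R4) : {for z, continuous (fun z : R4 => z.1.2)}.
Proof. exact: (@continuous_comp _ _ _ fst snd z cvg_fst cvg_snd). Qed.
Let sc (z : R4) : {for z, continuous (fun z : R4 => z.2.1)}.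
Proof. exact: (@continuous_comp _ _ _ snd fst z cvg_snd cvg_fst). Qed.
Let wc (z : R4) : {for z, continuous (fun z : R4 => z.2.2)}.
Proof. exact: (@continuous_comp _ _ _ snd snd z cvg_snd cvg_snd). Qed.

Let qc (z : R4) : {for z, continuous (fun z : R4 => 1 - z.1.1)}.
Proof. by apply: cvgB; [exact: cvg_cst|exact: pc]. Qed.

Lemma turn_continuous b : continuous (@turn R b).
Proof.
case: b => z; first exact: cvg_id.
exact: cvg_pair (cvg_pair (@qc z) (cvgN (@rc z))) (cvg_pair (@wc z) (cvgN (@sc z))).
Qed.

Lemma unturn_continuous b : continuous (@unturn R b).
Proof.
case: b => z; first exact: cvg_id.
exact: cvg_pair (cvg_pair (@qc z) (cvgN (@rc z))) (cvg_pair (cvgN (@wc z)) (@sc z)).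
Qed.

Lemma flat_continuous (z : R4) : z.1.1 != 1 -> {for z, continuous flat}.
Proof.
move=> z1; have d0 : 1 - z.1.1 != 0 by rewrite subr_eq0 eq_sym.
have vc : {for z, continuous (fun z : R4 => (1 - z.1.1)^-1)}.
  by apply: cvgV; [exact: d0|exact: qc].
have c1 : {for z, continuous (fun z : R4 => z.1.2 / (1 - z.1.1))}.
  by apply: cvgM; [exact: rc|exact: vc].
have c2 : {for z, continuous (fun z : R4 => z.2.1 / (1 - z.1.1))}.
  by apply: cvgM; [exact: sc|exact: vc].
exact: row2_continuous c1 c2.
Qed.

Lemma entry_continuous i : continuous (fun y : 'rV[R]_2 => y 0 i).
Proof. exact: matrix_normedtype.coord_continuous. Qed.

Lemma strip_continuous : continuous (@strip R).
Proof.
move=> y; have xc := @entry_continuous 0 y; have yc := @entry_continuous 1 y.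
have nc : {for y, continuous (fun y : 'rV[R]_2 => `|y 0 0|)}.
  exact: (continuous_comp xc (@norm_continuous _ R^o _)).
have oc : {for y, continuous (fun y : 'rV[R]_2 => 1 - `|y 0 0|)}.
  have cc : {for y, continuous (cst 1 : 'rV[R]_2 -> R)} by exact: cst_continuous.
  exact: (@cvgB R R _ (nbhs y) _ (cst 1) (fun y : 'rV[R]_2 => `|y 0 0|) 1 _ cc nc).
have ox : {for y, continuous (fun y : 'rV[R]_2 => (1 - `|y 0 0|) * y 0 0)}.
  exact: (continuousM oc xc).
have oy : {for y, continuous (fun y : 'rV[R]_2 => (1 - `|y 0 0|) * y 0 1)}.
  exact: (continuousM oc yc).
have xy : {for y, continuous (fun y : 'rV[R]_2 => y 0 0 * y 0 1)}.
  exact: (continuousM xc yc).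
exact: cvg_pair (cvg_pair nc ox) (cvg_pair oy xy).
Qed.

Let S0 : S (0, 0, (0, 0)).
Proof. by split; rewrite /= ?normr0 ?mul0r ?mulr0 // expr2 mul0r mul0r. Qed.

Definition to_mobius (z : R4) : S :=
  if pselect (S z) is left Sz then exist (fun u => u \in S) z (mem_set Sz)
  else exist (fun u => u \in S) _ (mem_set S0).

Lemma to_mobiusK z : S z -> set_val (to_mobius z) = z.
Proof. by rewrite /to_mobius; case: pselect. Qed.

Lemma mobius_valP (p : S) : S (set_val p).
Proof. exact: set_valP. Qed.

Lemma mobius_inj (p q : S) : set_val p = set_val q -> p = q.
Proof. by move=> pq; exact: val_inj. Qed.

Definition mobius_dom (b : bool) : set S :=
  [set p | (turn b (set_val p)).1.1 != 1].
Definition mobius_coord (b : bool) (p : S) : 'rV[R]_2 :=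
  flat (turn b (set_val p)).
Definition mobius_icoord (b : bool) (y : 'rV[R]_2) : S :=
  to_mobius (unturn b (strip y)).

Lemma mobius_icoordE b (y : 'rV[R]_2) : `|y 0 0| < 1 ->
  set_val (mobius_icoord b y) = unturn b (strip y).
Proof.
by move=> y1; apply/to_mobiusK/mobius_unturn/strip_mobius/ltW.
Qed.

Let codE b : mobius_coord b @` mobius_dom b = [set y : 'rV[R]_2 | `|y 0 0| < 1].
Proof.
apply/seteqP; split=> [_ [p bp <-]|y y1].
  have Sp := mobius_turn b (mobius_valP p).
  rewrite /mobius_coord /= flat_bound // lt_neqAle bp /=.
  by have /andP[] := mobius_bounds Sp.
exists (mobius_icoord b y); rewrite /mobius_dom /mobius_coord /= mobius_icoordE //.
  by rewrite unturnK /= lt_eqF.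
by rewrite unturnK stripK.
Qed.

Let coordK' b p : mobius_dom b p -> mobius_icoord b (mobius_coord b p) = p.
Proof.
move=> bp; apply: mobius_inj; have Sp := mobius_turn b (mobius_valP p).
by rewrite mobius_icoordE /mobius_coord ?flatK ?turnK // flat_bound //
  lt_neqAle bp; have /andP[] := mobius_bounds Sp.
Qed.

Let hausdorff' : hausdorff_space S.
Proof.
have hR : hausdorff_space R by exact: Rhausdorff.
have h4 : hausdorff_space R4 by do 2! apply: hausdorff_prod.
move=> p q pq; apply: mobius_inj.
exact: (cluster_map_eq (@initial_continuous _ _ set_val) h4 pq).
Qed.

Let countable' : @second_countable S.
Proof.
have cR := @second_countable_R R.
by apply: second_countable_sub; do 2! apply: second_countable_prod.
Qed.

Let turn_val_continuous b : continuous (turn b \o (set_val : S -> R4)).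
Proof.
move=> p; apply: continuous_comp; last exact: turn_continuous.
exact: initial_continuous.
Qed.

Let dom_open' b : open (mobius_dom b).
Proof.
have o1 : open [set z : R4 | z.1.1 != 1].
  apply: (@open_comp _ _ (fun z : R4 => z.1.1) [set x | x != 1]).
    by move=> z _; exact: pc.
  exact: open_neq.
by apply: (@open_comp _ _ _ _ _ o1) => p _; exact: turn_val_continuous.
Qed.

Let disc_open : open [set y : 'rV[R]_2 | `|y 0 0| < 1].
Proof.
apply: (@open_comp _ _ (fun y : 'rV[R]_2 => `|y 0 0|) [set x | x < 1]).
  move=> y _; exact: (continuous_comp (@entry_continuous 0 y) (@norm_continuous _ R^o _)).
exact: open_lt.
Qed.

Let cod_open' b : open (mobius_coord b @` mobius_dom b).
Proof. by rewrite codE. Qed.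

Let coord_continuous' b p : mobius_dom b p ->
  {for p, continuous (mobius_coord b)}.
Proof.
move=> bp; have tc := @turn_val_continuous b p.
by apply: (continuous_comp tc); exact: flat_continuous.
Qed.

Let icoord_continuous' b y : (mobius_coord b @` mobius_dom b) y ->
  {for y, continuous (mobius_icoord b)}.
Proof.
rewrite codE => y1; apply: initial_continuous_for.
have uc : {for y, continuous (unturn b \o @strip R)}.
  by apply: continuous_comp; [exact: strip_continuous|exact: unturn_continuous].
have yE : \forall z \near y, (unturn b \o @strip R) z =
    (set_val \o mobius_icoord b) z.
  by apply: (open_near disc_open) => // z z1; rewrite /= mobius_icoordE.
move=> A; rewrite /= mobius_icoordE // => /uc.
by rewrite /nbhs /=; apply: filterS2 yE => z /= <-.
Qed.

Definition mobius_chart_at (p : S) : bool := (set_val p).1.1 != 1.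

Let dom_chart_at' p : mobius_dom (mobius_chart_at p) p.
Proof.
rewrite /mobius_chart_at /mobius_dom /=.
case: (boolP ((set_val p).1.1 != 1)) => [//|].
by rewrite negbK => /eqP /= ->; rewrite subrr eq_sym oner_eq0.
Qed.

Lemma mobius_transitionE b (y : 'rV[R]_2) : `|y 0 0| < 1 -> y 0 0 != 0 ->
  mobius_coord (~~ b) (mobius_icoord b y) =
  scale_snd ((-1) ^+ (~~ b) * Num.sg (y 0 0)) y + row2 (- Num.sg (y 0 0)) 0.
Proof.
move=> y1 y0; rewrite /mobius_coord mobius_icoordE //.
case: b => /=; first by rewrite flat_turn // expr0 mul1r.
by rewrite flat_unturn // expr1 mulN1r.
Qed.

Lemma mobius_overlap b : mobius_coord b @` (mobius_dom b `&` mobius_dom (~~ b)) =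
  [set y : 'rV[R]_2 | `|y 0 0| < 1 /\ y 0 0 != 0].
Proof.
have xE p : mobius_dom b p ->
    (mobius_coord b p 0 0 != 0) = ((turn (~~ b) (set_val p)).1.1 != 1).
  move=> bp; have Sp := mobius_turn b (mobius_valP p).
  rewrite -(normr_eq0 (mobius_coord b p 0 0)) (flat_bound Sp bp).
  by case: b {bp Sp}; congr negb; apply/eqP/eqP => /=; lra.
apply/seteqP; split=> [_ [p [bp nbp] <-]|y [y1 y0]].
  split; last by rewrite xE.
  by have : (mobius_coord b @` mobius_dom b) (mobius_coord b p);
    [exists p|rewrite codE].
have : (mobius_coord b @` mobius_dom b) y by rewrite codE.
by move=> [p bp yE]; exists p => //; split=> //; rewrite /mobius_dom /= -xE // yE.
Qed.

(** For s = 1 and s = -1, the two components of the overlap of the two charts. *)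
Definition half_strip (s : R) : set 'rV[R]_2 :=
  [set y | `|y 0 0| < 1 /\ 0 < s * y 0 0].

Lemma half_strip_open s : open (half_strip s).
Proof.
apply: openI => //.
apply: (@open_comp _ _ (fun y : 'rV[R]_2 => s * y 0 0) [set x | 0 < x]).
  move=> y _; apply: (@continuous_comp _ _ _ (fun y : 'rV[R]_2 => y 0 0)).
    exact: entry_continuous.
  exact: mulrl_continuous.
exact: open_gt.
Qed.

Lemma half_strip_transition b s y : s ^+ 2 = 1 -> half_strip s y ->
  (mobius_coord (~~ b) \o mobius_icoord b) y =
  y *m diag_mx (row2 1 ((-1) ^+ (~~ b) * s)) + row2 (- s) 0.
Proof.
move=> s2 [y1 sy0].
have sE : Num.sg (y 0 0) = s.
  have sg : Num.sg s = s.
    have /eqP := s2; rewrite sqrf_eq1.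
    by move=> /orP[] /eqP ->; rewrite ?sgrN ?sgr1.
  have : Num.sg (s * y 0 0) = 1 by exact: gtr0_sg.
  by rewrite sgrM sg => /(congr1 ( *%R s)); rewrite mulrA -expr2 s2 mul1r mulr1.
have y0 : y 0 0 != 0 by apply: contraTneq sy0 => ->; rewrite mulr0 ltxx.
by rewrite /= mobius_transitionE // sE.
Qed.

Lemma mobius_transition_smooth b b' :
  smooth_on (mobius_coord b @` (mobius_dom b `&` mobius_dom b'))
    (mobius_coord b' \o mobius_icoord b).
Proof.
move=> r; have [<-|bb'] := eqVneq b b'.
  rewrite setIid.
  have hid : Cr (mobius_coord b @` mobius_dom b) r (@id 'rV[R]_2) by exact: Cr_id.
  apply: (Cr_ext (@cod_open' b) _ hid).
  by move=> _ [p bp <-]; rewrite /= coordK'.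
have -> : b' = ~~ b by case: b b' bb' => -[].
rewrite mobius_overlap.
have -> : [set y : 'rV[R]_2 | `|y 0 0| < 1 /\ y 0 0 != 0] =
    half_strip 1 `|` half_strip (-1).
  apply/seteqP; split=> y; rewrite /half_strip /= mul1r mulN1r oppr_gt0.
    by case=> y1; rewrite neq_lt => /orP[]; [right|left].
  by case=> -[y1 y0]; split=> //; rewrite neq_lt y0 ?orbT.
have sD s : s ^+ 2 = 1 ->
    Cr (half_strip s) r (mobius_coord (~~ b) \o mobius_icoord b).
  move=> s2; have oD := @half_strip_open s.
  have hid : Cr (half_strip s) r (@id 'rV[R]_2) by exact: Cr_id.
  have hl := Cr_linear oD (@linear_rV_continuous _ _ _
    (mulmxr (diag_mx (row2 1 ((-1) ^+ (~~ b) * s))))) hid.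
  have hc : Cr (half_strip s) r (cst (row2 (- s) 0) : 'rV[R]_2 -> 'rV[R]_2).
    exact: Cr_cst.
  apply: (Cr_ext oD _ (Cr_add oD hl hc)) => y sy.
  by rewrite [RHS](half_strip_transition b s2 sy).
by apply: Cr_union; apply: sD; rewrite ?sqrrN expr1n.
Qed.

Definition mobius : manifold R 2 :=
  @Manifold R 2 S bool mobius_dom mobius_coord mobius_icoord mobius_chart_at
    hausdorff' countable' dom_open' cod_open' coordK' coord_continuous'
    icoord_continuous' dom_chart_at' mobius_transition_smooth.

End MobiusManifold.

(** * The theorem *)

Section Nonorientable.
Context {R : realType}.

Let M := @mobius R.

Lemma mobius_nonorientable : ~ orientable M.
Proof.
move=> [h [hc hpos]].
pose pt b (t : R) : M := mobius_icoord b (row2 t 0).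
have ptE b t : `|t| < 1 -> mobius_dom b (pt b t) /\
    mobius_coord b (pt b t) = row2 t 0.
  move=> t1; rewrite /mobius_dom /mobius_coord /pt /= mobius_icoordE ?row2E //.
  by rewrite unturnK stripK /= ?row2E // lt_eqF.
have abs_half (s : R) : s ^+ 2 = 1 -> `|s / 2| < 1.
  by move=> s2; rewrite -(ltr_pXn2r (n := 2)) ?nnegrE // real_normK ?num_real //
    expr1n exprMn s2; lra.
(* On the core circle y = 0, the points x = 1 / 2 and x = - 1 / 2 lie in the two
   components of the overlap. *)
have detE s : s ^+ 2 = 1 -> \det ('J (@coord _ _ M false \o @icoord _ _ M true)
    (row2 (s / 2) 0)) = s.
  move=> s2; have s0 : half_strip s (row2 (s / 2) 0 : 'rV[R]_2).
    rewrite /half_strip /= row2E; split; first exact: abs_half.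
    by rewrite mulrA -expr2 s2; lra.
  have tE : \forall y \near (row2 (s / 2) 0 : 'rV[R]_2),
      y *m diag_mx (row2 1 s) + row2 (- s) 0 =
      (@coord _ _ M false \o @icoord _ _ M true) y.
    apply: (open_near (@half_strip_open R s) s0) => y sy.
    by apply/esym; rewrite [LHS](half_strip_transition true s2 sy) expr0 mul1r.
  have dA : differentiable (fun y => y *m diag_mx (row2 1 s) + row2 (- s) 0 : 'rV[R]_2)
      (row2 (s / 2) 0).
    apply: differentiableD; last exact: differentiable_cst.
    by apply: (@linear_differentiable _ _ _ (mulmxr _)); exact: linear_rV_continuous.
  apply: etrans (congr1 determinant (esym (near_eq_jacobian dA tE))) _.
  apply: etrans (congr1 determinant (jacobian_affine _ _ _)) _.
  rewrite det_diag !big_ord_recl big_ord0 mulr1 (_ : lift ord0 ord0 = 1).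
    by rewrite !row2E mul1r.
  exact: val_inj.
have half_dom s : s ^+ 2 = 1 -> mobius_dom false (pt true (s / 2)).
  move=> s2; rewrite /mobius_dom /pt /= mobius_icoordE /= ?row2E ?abs_half //.
  have s0 : s / 2 != 0.
    by rewrite mulf_neq0 ?invr_eq0 ?pnatr_eq0 // -sqrf_eq0 s2 oner_eq0.
  by apply/eqP => h1; case/eqP: s0; apply: normr0_eq0; lra.
have half_pt s : s ^+ 2 = 1 -> pt true (s / 2) = pt false (- (s / 2)).
  move=> s2; rewrite -[LHS](@coordK _ _ M false) /=; last exact: half_dom.
  have s0 : half_strip s (row2 (s / 2) 0 : 'rV[R]_2).
    rewrite /half_strip /= row2E; split; first exact: abs_half.
    by rewrite mulrA -expr2 s2; lra.
  rewrite /pt; congr mobius_icoord.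
  rewrite [LHS](half_strip_transition true s2 s0).
  apply: row2P; rewrite [LHS]mxE scale_sndE !row2E; last by rewrite mul0r addr0.
  by lra.
have key s : s ^+ 2 = 1 ->
    0 < h true (pt true (s / 2)) * h false (pt false (- (s / 2))) * s.
  move=> s2; have [d1 c1] := ptE true _ (abs_half _ s2).
  have := hpos true false _ d1 (half_dom _ s2).
  by rewrite [coord _ _]c1 detE // half_pt.
have same b : 0 < h b (pt b (- (1 / 2))) * h b (pt b (1 / 2)).
  apply: (@nonvanishing_same_sign R (fun t => h b (pt b t))); first lra.
  move=> t; rewrite in_itv /= => /andP[t1 t2].
  have t3 : `|t| < 1 by rewrite ltr_norml; lra.
  have [d1 c1] := ptE b _ t3; split.
    have ct : {for t, continuous (fun t => row2 t 0 : 'rV[R]_2)}.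
      by apply: row2_continuous; [exact: cvg_id|exact: cvg_cst].
    have ci : {for row2 t 0, continuous (@icoord _ _ M b)}.
      by apply: icoord_continuous; exists (pt b t).
    exact: (continuous_comp ct (continuous_comp ci (hc b _ d1))).
  by have := hpos b b _ d1 d1; apply: contraTneq => ->; rewrite !mul0r ltxx.
(* The signs of the two charts agree at one of the two points and differ at the
   other, while each chart has the same sign at both. *)
have k1 := key 1 (expr1n _ _); have k2 := key (-1).
have st := same true; have sf := same false.
rewrite sqrrN expr1n mulNr opprK in k2; move: (k2 erefl) k1 st sf.
move: (h true _) (h true _) (h false _) (h false _) => a b c d; nra.
Qed.

End Nonorientable.

Theorem mainTheorem2 (R : realType) :
  exists (n k : nat) (M : manifold R n) (G : lieGroupoid k M),
    ~ (exists Theta, is_representation G Theta /\ induces_canonical G Theta).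
Proof.
exists 2%N, 2%N, (@mobius R), (pair_groupoid (@mobius R)).
move=> [Th [Threp _]].
apply: (@mobius_nonorientable R).
exact: (@pair_representation_orientable _ _ (@mobius R) (mobius_icoord true 0) _ Threp).
Qed.
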